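(* Let $\mathbf{u}\in C^1([0,T);V^m)$, $m\ge1$, be a strong solution of the Euler equations on the lattice $\mathbb{\Lambda}^d$. If $d=3$, the energy $E(t)=\tfrac12(\mathbf{u},\mathbf{u})$ and the helicity $H(t)=(\mathbf{u},\boldsymbol\omega)$ are constant in $t\in[0,T)$. If $d=2$, the energy $E(t)=\tfrac12(\mathbf{u},\mathbf{u})$ and the enstrophy $\Omega(t)=\tfrac12(\boldsymbol\omega,\boldsymbol\omega)$ are constant in $t\in[0,T)$.
   Context: Let $\lambda$ be one of: $2$; the plastic number $\sigma$ (unique real root of $x^3-x-1=0$); or $\lambda>1$ with $\lambda^b-\lambda^a=1$ for mutually prime integers $0\le a<b\le62$, $(a,b)\notin\{(1,3),(4,5)\}$. Let $\mathbb{\Lambda}=\{0\}\cup\{\pm\lambda^n:n=0,1,2,\dots\}$ and $d\in\{2,3\}$. Fields on $\mathbb{\Lambda}^d$ satisfy $f(-\mathbf{k})=\overline{f(\mathbf{k})}$. Derivatives $(\partial_jf)(\mathbf{k})=ik_jf(\mathbf{k})$, $(\nabla p)(\mathbf{k})=i\mathbf{k}p(\mathbf{k})$, $(\nabla\cdot\mathbf{u})(\mathbf{k})=i\mathbf{k}\cdot\mathbf{u}(\mathbf{k})$; vorticity $\boldsymbol\omega(\mathbf{k})=i\mathbf{k}\times\mathbf{u}(\mathbf{k})$ for $d=3$ and scalar $\omega(\mathbf{k})=i(k_1u_2(\mathbf{k})-k_2u_1(\mathbf{k}))$ for $d=2$. Inner product $(f,g)=\sum_{\mathbf{k}}f(\mathbf{k})\overline{g(\mathbf{k})}$,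 summed over components for vector fields. Product $(f\ast g)(\mathbf{k})=\sum_{\mathbf{p}+\mathbf{q}=\mathbf{k},\,\mathbf{p},\mathbf{q}\in\mathbb{\Lambda}^d}f(\mathbf{p})g(\mathbf{q})$; $(\mathbf{u}\ast\nabla\mathbf{u})_i=\sum_j u_j\ast\partial_ju_i$. For integer $m\ge0$, $\|\mathbf{u}\|_{h^m}^2=\sum_{\mathbf{k}\neq\mathbf{0}}|\mathbf{k}|^{2m}|\mathbf{u}(\mathbf{k})|^2$; $V^m$ is the space of fields with $\mathbf{u}(\mathbf{0})=\mathbf{0}$, $\nabla\cdot\mathbf{u}=0$ and finite $h^m$ norm, normed by $\|\cdot\|_{h^m}$. A strong solution on $[0,T)$ is $\mathbf{u}\in C^1([0,T);V^m)$ together with a scalar field $p(\cdot,t)$ such that $\partial_t\mathbf{u}+\mathbf{u}\ast\nabla\mathbf{u}=-\nabla p$ holds for all $\mathbf{k}\neq\mathbf{0}$ and $t\in[0,T)$. *)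

(* Defs.v *)
From Stdlib Require Import Reals Lra ZArith List Arith Classical ClassicalEpsilon.
From Coquelicot Require Import Coquelicot.
Import ListNotations.
Open Scope R_scope.

Definition lam_admissible (lam : R) : Prop :=
  lam = 2
  \/ lam ^ 3 - lam - 1 = 0   (* plastic number: the unique real root *)
  \/ (1 < lam /\ exists a b : nat,
        (a < b)%nat /\ (b <= 62)%nat /\ Nat.gcd a b = 1%nat /\
        (a, b) <> (1%nat, 3%nat) /\ (a, b) <> (4%nat, 5%nat) /\
        lam ^ b - lam ^ a = 1).

Definition inLam (lam x : R) : Prop :=
  x = 0 \/ exists n : nat, x = lam ^ n \/ x = - lam ^ n.

Definition wvec := nat -> R.
Definition inLamd (lam : R) (d : nat) (k : wvec) : Prop :=
  (forall j, (j < d)%nat -> inLam lam (k j)) /\ (forall j, (d <= j)%nat -> k j = 0).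
Definition vnonzero (d : nat) (k : wvec) : Prop := exists j, (j < d)%nat /\ k j <> 0.
Definition vneg (k : wvec) : wvec := fun j => - k j.
Definition knorm2 (d : nat) (k : wvec) : R :=
  fold_right Rplus 0 (map (fun j => k j ^ 2) (seq 0 d)).

Definition sfield := wvec -> C.
Definition vfield := nat -> sfield.

(* ---- finite truncations of Lambda^d, exhausting Lambda^d as N -> oo ---- *)
Definition lam_list (lam : R) (N : nat) : list R :=
  0 :: flat_map (fun n => [lam ^ n; - lam ^ n]) (seq 0 N).
Fixpoint box (lam : R) (N d : nat) : list wvec :=
  match d with
  | O => [fun _ => 0]
  | S d' => flat_map (fun k => map (fun x => fun j => if Nat.eqb j d' then x else k j)
                                   (lam_list lam N)) (box lam N d')
  end.

Definition Csum {A : Type} (l : list A) (F : A -> C) : C :=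
  fold_right (fun a acc => Cplus (F a) acc) (RtoC 0) l.
Definition Rsum {A : Type} (l : list A) (F : A -> R) : R :=
  fold_right (fun a acc => F a + acc) 0 l.

Definition Clim (s : nat -> C) : C :=
  (real (Lim_seq (fun n => Re (s n))), real (Lim_seq (fun n => Im (s n)))).

Definition cdec (P : Prop) : bool := if excluded_middle_informative P then true else false.

Definition inner (lam : R) (d n : nat) (f g : vfield) : C :=
  Clim (fun N => Csum (box lam N d)
         (fun k => Csum (seq 0 n) (fun i => Cmult (f i k) (Cconj (g i k))))).

Definition vsum_eq (d : nat) (p q k : wvec) : Prop :=
  forall j, (j < d)%nat -> p j + q j = k j.
Definition conv (lam : R) (d : nat) (f g : sfield) : sfield := fun k =>
  Clim (fun N => Csum (box lam N d) (fun p => Csum (box lam N d) (fun q =>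
          if cdec (vsum_eq d p q k) then Cmult (f p) (g q) else RtoC 0))).

Definition dpart (j : nat) (f : sfield) : sfield := fun k => Cmult (Cmult Ci (RtoC (k j))) (f k).
Definition grad (p : sfield) : vfield := fun i => dpart i p.
Definition divergence (d : nat) (u : vfield) : sfield := fun k =>
  Csum (seq 0 d) (fun j => dpart j (u j) k).
Definition advect (lam : R) (d : nat) (u : vfield) : vfield := fun i k =>
  Csum (seq 0 d) (fun j => conv lam d (u j) (dpart j (u i)) k).

Definition vort3 (u : vfield) : vfield := fun i k =>
  match i with
  | 0%nat => Cmult Ci (Cminus (Cmult (RtoC (k 1%nat)) (u 2%nat k)) (Cmult (RtoC (k 2%nat)) (u 1%nat k)))
  | 1%nat => Cmult Ci (Cminus (Cmult (RtoC (k 2%nat)) (u 0%nat k)) (Cmult (RtoC (k 0%nat)) (u 2%nat k)))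
  | 2%nat => Cmult Ci (Cminus (Cmult (RtoC (k 0%nat)) (u 1%nat k)) (Cmult (RtoC (k 1%nat)) (u 0%nat k)))
  | _ => RtoC 0
  end.
Definition vort2 (u : vfield) : sfield := fun k =>
  Cmult Ci (Cminus (Cmult (RtoC (k 0%nat)) (u 1%nat k)) (Cmult (RtoC (k 1%nat)) (u 0%nat k))).

Definition real_sfield (lam : R) (d : nat) (f : sfield) : Prop :=
  forall k, inLamd lam d k -> f (vneg k) = Cconj (f k).

Definition hm_partial (lam : R) (d m : nat) (u : vfield) (N : nat) : R :=
  Rsum (box lam N d) (fun k =>
    if cdec (vnonzero d k)
    then knorm2 d k ^ m * Rsum (seq 0 d) (fun i => Cmod (u i k) ^ 2) else 0).
Definition hm_sq (lam : R) (d m : nat) (u : vfield) : R :=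
  real (Lim_seq (hm_partial lam d m u)).

Definition inV (lam : R) (d m : nat) (u : vfield) : Prop :=
  (forall i, (i < d)%nat -> real_sfield lam d (u i)) /\
  (forall i, (i < d)%nat -> u i (fun _ => 0) = RtoC 0) /\
  (forall k, inLamd lam d k -> divergence d u k = RtoC 0) /\
  (exists B : R, forall N, hm_partial lam d m u N <= B).

Definition vsub (u v : vfield) : vfield := fun i k => Cminus (u i k) (v i k).
Definition vscal (r : R) (u : vfield) : vfield := fun i k => Cmult (RtoC r) (u i k).

Definition inI (T : Rbar) (t : R) : Prop := 0 <= t /\ Rbar_lt (Finite t) T.

Definition C1_Vm (lam : R) (d m : nat) (T : Rbar) (u u' : R -> vfield) : Prop :=
  (forall t, inI T t -> inV lam d m (u t) /\ inV lam d m (u' t)) /\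
  (forall t, inI T t -> forall eps, 0 < eps -> exists delta, 0 < delta /\
     forall h, h <> 0 -> Rabs h < delta -> inI T (t + h) ->
       hm_sq lam d m (vsub (vscal (/ h) (vsub (u (t + h)) (u t))) (u' t)) < eps) /\
  (forall t, inI T t -> forall eps, 0 < eps -> exists delta, 0 < delta /\
     forall s, inI T s -> Rabs (s - t) < delta ->
       hm_sq lam d m (vsub (u' s) (u' t)) < eps).

Definition strong_solution (lam : R) (d m : nat) (T : Rbar)
    (u : R -> vfield) (p : R -> sfield) : Prop :=
  exists u' : R -> vfield,
    C1_Vm lam d m T u u' /\
    (forall t, inI T t -> real_sfield lam d (p t)) /\
    (forall t, inI T t -> forall k, inLamd lam d k -> vnonzero d k ->
       forall i, (i < d)%nat ->
         Cplus (u' t i k) (advect lam d (u t) i k) = Copp (grad (p t) i k)).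

Definition energy (lam : R) (d : nat) (u : vfield) : C :=
  Cmult (RtoC (1/2)) (inner lam d d u u).
Definition helicity (lam : R) (u : vfield) : C := inner lam 3 3 u (vort3 u).
Definition enstrophy (lam : R) (u : vfield) : C :=
  Cmult (RtoC (1/2)) (inner lam 2 1 (fun _ => vort2 u) (fun _ => vort2 u)).

(* Main.v *)
(* Energy, helicity and enstrophy are quadratic forms sum_k b_k(u(k), u(k)) with
   |b_k(x, y)| <= c (1 + |k|^2) |x| |y|, so along a C^1 curve in V^m, m >= 1, their
   derivative vanishes as soon as sum_(k in box N) b_k(u'(k), u(k)) -> 0.  Writing
   b_k(x, u(k)) = Re (x . conj Z(k)) with Z = u, curl u or curl curl u, the pressure
   drops out because k . Z(k) = 0, and what remains is a sum over triads p + q + r = 0.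
   Restricted to p, q, r in box N this cubic form vanishes identically, by the
   classical antisymmetries.  The triads with r in box N that leave the box contribute
   at most C F(p) F(q) F(r) with F(k) = |k| |u(k)| in l^2; for the enstrophy this holds
   because then |r| <= C |p|, while u(p) . q = - u(p) . r.

   Triad sums of F(p) F(q) F(r) converge for l^2 data, for every lambda > 1.  In one
   dimension, two members of each triad are comparable and determine the third
   member, so a Schur test with geometric weights applies; the bound then tensorizes
   over the coordinates. *)
Require Import Defs.
From Stdlib Require Import Reals Lra Lia Arith List Classical ClassicalEpsilon FunctionalExtensionality.
From Coquelicot Require Import Coquelicot.
Import ListNotations.
Open Scope R_scope.

(** Summability of F(p) F(q) F(r) over triads for square-summable F fails on Z^d; it rests on the
    sparsity of the lattice and is the reason why m = 1 suffices. The main obstacle is an order of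
    limits. The advection term at a fixed r is a limit of sums over p, q in box M, and only then
    does r run over box N, while the antisymmetries need p, q, r in one common box. Passing from one
    to the other costs a tail of the triad series. For the enstrophy the flux carries one derivative
    too many on q and need not be dominated on all triads, only on those that leave the box; the
    limit argument therefore asks for domination on these alone. A second obstacle is that [Lim_seq]
    and [real] are total: the expressions [conv], [hm_sq] and [inner] have their intended values
    only once the underlying sequences are known to converge, so the existence of each limit
    precedes its use. *)

(** * Finite sums over lists and the Cauchy-Schwarz inequality *)

Lemma cdec_true (P : Prop) : P -> cdec P = true.
Proof. unfold cdec; destruct (excluded_middle_informative P); tauto. Qed.

Lemma cdec_false (P : Prop) : ~ P -> cdec P = false.
Proof. unfold cdec; destruct (excluded_middle_informative P); tauto. Qed.

Lemma cdec_iff (P Q : Prop) : (P <-> Q) -> cdec P = cdec Q.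
Proof.
unfold cdec; destruct (excluded_middle_informative P), (excluded_middle_informative Q); tauto.
Qed.

Ltac case_cdec P :=
  let H := fresh "H" in
  destruct (classic P) as [H|H];
  [rewrite ?(cdec_true _ H) | rewrite ?(cdec_false _ H)].

Lemma Rsum_ext_in {A} (l : list A) F G :
  (forall a, In a l -> F a = G a) -> Rsum l F = Rsum l G.
Proof.
induction l as [|a l IH]; simpl; intros H; auto.
rewrite H by auto. f_equal; auto.
Qed.

Lemma Rsum_ext {A} (l : list A) F G : (forall a, F a = G a) -> Rsum l F = Rsum l G.
Proof. intros H; apply Rsum_ext_in; auto. Qed.

Lemma Rsum_plus {A} (l : list A) F G : Rsum l (fun a => F a + G a) = Rsum l F + Rsum l G.
Proof. induction l as [|a l IH]; simpl; [|rewrite IH]; ring. Qed.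

Lemma Rsum_scal {A} (l : list A) c F : Rsum l (fun a => c * F a) = c * Rsum l F.
Proof. induction l as [|a l IH]; simpl; [|rewrite IH]; ring. Qed.

Lemma Rsum_zero {A} (l : list A) : Rsum l (fun _ => 0) = 0.
Proof. induction l as [|a l IH]; simpl; [|rewrite IH]; ring. Qed.

Lemma Rsum_eq0 {A} (l : list A) F : (forall a, F a = 0) -> Rsum l F = 0.
Proof. intros H. rewrite (Rsum_ext _ _ _ H). apply Rsum_zero. Qed.

Lemma Rsum_minus {A} (l : list A) F G : Rsum l (fun a => F a - G a) = Rsum l F - Rsum l G.
Proof. induction l as [|a l IH]; simpl; [|rewrite IH]; ring. Qed.

Lemma Rsum_le {A} (l : list A) F G : (forall a, In a l -> F a <= G a) -> Rsum l F <= Rsum l G.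
Proof.
induction l as [|a l IH]; simpl; intros H; [lra|].
apply Rplus_le_compat; auto.
Qed.

Lemma Rsum_nonneg {A} (l : list A) F : (forall a, In a l -> 0 <= F a) -> 0 <= Rsum l F.
Proof. intros H. rewrite <- (Rsum_zero l). now apply Rsum_le. Qed.

Lemma Rsum_ge_term {A} (l : list A) F a :
  In a l -> (forall b, In b l -> 0 <= F b) -> F a <= Rsum l F.
Proof.
induction l as [|b l IH]; simpl; [tauto|]. intros [->|Ha] HF.
- pose proof (Rsum_nonneg l F ltac:(auto)). lra.
- pose proof (HF b ltac:(auto)). pose proof (IH Ha ltac:(auto)). lra.
Qed.

Lemma Rsum_Rabs {A} (l : list A) F : Rabs (Rsum l F) <= Rsum l (fun a => Rabs (F a)).
Proof.
induction l as [|a l IH]; simpl; [rewrite Rabs_R0; lra|].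
eapply Rle_trans; [apply Rabs_triang|]. lra.
Qed.

Lemma Rsum_app {A} (l l' : list A) F : Rsum (l ++ l') F = Rsum l F + Rsum l' F.
Proof. induction l as [|a l IH]; simpl; [|rewrite IH]; ring. Qed.

Lemma Rsum_map {A B} (l : list A) (g : A -> B) F : Rsum (map g l) F = Rsum l (fun a => F (g a)).
Proof. induction l as [|a l IH]; simpl; [|rewrite IH]; ring. Qed.

Lemma Rsum_flat_map {A B} (l : list A) (g : A -> list B) F :
  Rsum (flat_map g l) F = Rsum l (fun a => Rsum (g a) F).
Proof. induction l as [|a l IH]; simpl; [|rewrite Rsum_app, IH]; ring. Qed.

Lemma Rsum_swap {A B} (l : list A) (l' : list B) F :
  Rsum l (fun a => Rsum l' (fun b => F a b)) = Rsum l' (fun b => Rsum l (fun a => F a b)).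
Proof.
induction l as [|a l IH]; simpl; [now rewrite Rsum_zero|].
now rewrite Rsum_plus, IH.
Qed.

Lemma Rsum_if {A} (l : list A) (b : bool) F :
  Rsum l (fun a => if b then F a else 0) = if b then Rsum l F else 0.
Proof. destruct b; auto using Rsum_zero. Qed.

Definition l2 {A} (l : list A) (f : A -> R) : R := sqrt (Rsum l (fun a => f a ^ 2)).

Lemma Rsum_sqr_nonneg {A} (l : list A) (f : A -> R) : 0 <= Rsum l (fun a => f a ^ 2).
Proof. apply Rsum_nonneg; intros; apply pow2_ge_0. Qed.

Lemma l2_nonneg {A} (l : list A) f : 0 <= l2 l f.
Proof. apply sqrt_pos. Qed.

Lemma l2_sqr {A} (l : list A) f : l2 l f ^ 2 = Rsum l (fun a => f a ^ 2).
Proof. unfold l2. rewrite pow2_sqrt; auto using Rsum_sqr_nonneg. Qed.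

Lemma l2_ge_term {A} (l : list A) f a : In a l -> f a <= l2 l f.
Proof.
intros Ha. apply Rsqr_incr_0_var; [|apply l2_nonneg].
rewrite !Rsqr_pow2, l2_sqr.
apply (Rsum_ge_term l (fun a => f a ^ 2)); auto using pow2_ge_0.
Qed.

Lemma Rsum_CS {A} (l : list A) f g : Rsum l (fun a => f a * g a) <= l2 l f * l2 l g.
Proof.
induction l as [|a l IH]; unfold l2 in *; simpl.
- rewrite sqrt_0; lra.
- set (F := Rsum l (fun a => f a * (f a * 1))) in *.
  set (G := Rsum l (fun a => g a * (g a * 1))) in *.
  set (P := Rsum l _) in *.
  assert (HF : 0 <= F) by apply Rsum_sqr_nonneg.
  assert (HG : 0 <= G) by apply Rsum_sqr_nonneg.
  pose proof (sqrt_pos F) as sF. pose proof (sqrt_pos G) as sG.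
  pose proof (sqrt_sqrt F HF) as eF. pose proof (sqrt_sqrt G HG) as eG.
  assert (HF' : 0 <= f a * (f a * 1) + F) by nra.
  assert (HG' : 0 <= g a * (g a * 1) + G) by nra.
  rewrite <- sqrt_mult by assumption.
  apply Rle_trans with (f a * g a + sqrt F * sqrt G); [apply Rplus_le_compat_l, IH|].
  apply Rsqr_incr_0_var; [|apply sqrt_pos].
  rewrite Rsqr_sqrt by (now apply Rmult_le_pos).
  (* Cauchy-Schwarz in the plane for [(f a, sqrt F)] and [(g a, sqrt G)]: the two sides differ by
     this square. *)
  pose proof (pow2_ge_0 (f a * sqrt G - g a * sqrt F)).
  replace ((f a * (f a * 1) + F) * (g a * (g a * 1) + G))
    with ((f a * f a + sqrt F * sqrt F) * (g a * g a + sqrt G * sqrt G))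
    by (rewrite eF, eG; ring).
  unfold Rsqr. nra.
Qed.

Lemma Rsum_CS2 {A B} (l : list A) (l' : list B) (f g : A -> B -> R) X Y :
  0 <= X -> 0 <= Y ->
  Rsum l (fun a => Rsum l' (fun b => f a b ^ 2)) <= X ^ 2 ->
  Rsum l (fun a => Rsum l' (fun b => g a b ^ 2)) <= Y ^ 2 ->
  Rsum l (fun a => Rsum l' (fun b => f a b * g a b)) <= X * Y.
Proof.
intros HX HY Hf Hg.
apply Rle_trans with (Rsum l (fun a => l2 l' (f a) * l2 l' (g a))).
{ apply Rsum_le; intros; apply Rsum_CS. }
eapply Rle_trans; [apply Rsum_CS|].
apply Rmult_le_compat; try apply l2_nonneg;
  (apply Rsqr_incr_0_var; [|assumption]; rewrite !Rsqr_pow2, l2_sqr;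
   erewrite Rsum_ext; [eassumption|intros; apply l2_sqr]).
Qed.

(** At most one term survives, since [P] has at most one solution and [l] has no repetition. This
    handles the member of a triad that is determined by the other two. *)
Lemma Rsum_point_le {A} (l : list A) (h : A -> R) (P : A -> Prop) B :
  NoDup l -> (forall a b, P a -> P b -> a = b) -> 0 <= B ->
  (forall a, In a l -> h a <= B) ->
  Rsum l (fun a => if cdec (P a) then h a else 0) <= B.
Proof.
intros Hl HP HB. induction Hl as [|a l Ha Hl IH]; simpl; intros Hh; [assumption|].
case_cdec (P a); [|specialize (IH ltac:(auto)); lra].
rewrite (Rsum_ext_in _ _ (fun _ => 0)), Rsum_zero; [specialize (Hh a ltac:(auto)); lra|].
intros b Hb. case_cdec (P b); [|auto].
exfalso; apply Ha. now rewrite (HP a b).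
Qed.

(** * The one-dimensional lattice *)

Lemma Rsum_lam_S lam N F :
  Rsum (lam_list lam (S N)) F = Rsum (lam_list lam N) F + F (lam ^ N) + F (- lam ^ N).
Proof.
unfold lam_list. rewrite seq_S, flat_map_app. simpl. rewrite Rsum_app. simpl. ring.
Qed.

Lemma lam_list_S lam N : lam_list lam (S N) = lam_list lam N ++ [lam ^ N; - lam ^ N].
Proof. unfold lam_list. rewrite seq_S, flat_map_app. reflexivity. Qed.

Lemma Rsum_lam_0 lam F : Rsum (lam_list lam 0) F = F 0.
Proof. simpl. ring. Qed.

Lemma lam_list_In lam N x :
  In x (lam_list lam N) -> x = 0 \/ exists n, (n < N)%nat /\ (x = lam ^ n \/ x = - lam ^ n).
Proof.
unfold lam_list; simpl. intros [<-|H]; [auto|right].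
apply in_flat_map in H. destruct H as [n [Hn Hx]]. apply in_seq in Hn.
exists n; split; [lia|]. destruct Hx as [<-|[<-|[]]]; auto.
Qed.

Lemma Rsum_lam_opp lam N F : Rsum (lam_list lam N) (fun x => F (- x)) = Rsum (lam_list lam N) F.
Proof.
induction N as [|N IH].
- rewrite !Rsum_lam_0. now rewrite Ropp_0.
- rewrite !Rsum_lam_S, IH, Ropp_involutive. ring.
Qed.

Section Lattice.
Variable lam : R.
Hypothesis lam_gt1 : 1 < lam.

Lemma lam_list_Rabs N x :
  In x (lam_list lam N) -> x = 0 \/ exists n, (n < N)%nat /\ Rabs x = lam ^ n.
Proof.
intros H. destruct (lam_list_In _ _ _ H) as [->|[n [Hn Hx]]]; [auto|right; exists n; split; auto].
pose proof (pow_lt lam n ltac:(lra)).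
destruct Hx as [-> | ->]; rewrite ?Rabs_Ropp, Rabs_pos_eq; lra.
Qed.

Lemma pow_step_le n m : (n < m)%nat -> lam * lam ^ n <= lam ^ m.
Proof. intros H. rewrite tech_pow_Rmult. apply Rle_pow; [lra|lia]. Qed.

Lemma lam_list_lt N x : In x (lam_list lam N) -> Rabs x < lam ^ N.
Proof.
intros H. destruct (lam_list_Rabs _ _ H) as [->|[n [Hn ->]]].
- rewrite Rabs_R0. apply pow_lt; lra.
- apply Rlt_pow; [lra|lia].
Qed.

Lemma lam_list_NoDup N : NoDup (lam_list lam N).
Proof.
induction N as [|N IH]; [simpl; repeat constructor; simpl; tauto|].
rewrite lam_list_S.
pose proof (pow_lt lam N ltac:(lra)) as Hp.
apply NoDup_app; auto.
- repeat constructor; simpl; intros H; [destruct H as [H|[]]; lra|tauto].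
- intros x Hx [<-|[<-|[]]]; apply lam_list_lt in Hx;
    rewrite ?Rabs_Ropp, Rabs_pos_eq in Hx; lra.
Qed.

(** If |y| and |z| are distinct powers, then |x| is at least their difference; the worst case |y| =
    lam |z| produces the ratio lam / (lam - 1). If |y| = |z|, then x <> 0 forces y = z and |x| = 2
    |y|. *)
Lemma triad_comparable N x y z :
  In x (lam_list lam N) -> In y (lam_list lam N) -> In z (lam_list lam N) ->
  x + y + z = 0 -> x <> 0 -> (lam - 1) * Rabs y <= lam * Rabs x.
Proof.
intros Hx Hy Hz E Hx0.
pose proof (Rabs_pos_lt x Hx0) as Px.
destruct (lam_list_Rabs _ _ Hy) as [->|[a [_ Ha]]].
{ rewrite Rabs_R0. nra. }
destruct (lam_list_Rabs _ _ Hz) as [->|[b [_ Hb]]].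
{ replace y with (- x) by lra. rewrite Rabs_Ropp. nra. }
pose proof (pow_lt lam a ltac:(lra)) as Pa. pose proof (pow_lt lam b ltac:(lra)) as Pb.
assert (Ex : Rabs x = Rabs (y + z)) by (rewrite <- Rabs_Ropp; f_equal; lra).
pose proof (Rabs_triang_inv y (- z)) as T1. pose proof (Rabs_triang_inv z (- y)) as T2.
rewrite Rabs_Ropp in T1, T2.
replace (y - - z) with (y + z) in T1 by ring. replace (z - - y) with (y + z) in T2 by ring.
destruct (lt_eq_lt_dec a b) as [[L|<-]|L].
- apply pow_step_le in L. nra.
- rewrite <- Hb in Ha. unfold Rabs in Ex, Ha |- *.
  destruct (Rcase_abs x), (Rcase_abs y), (Rcase_abs z), (Rcase_abs (y + z)); nra.
- apply pow_step_le in L. nra.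
Qed.

Lemma lam_geom_sum N X : 0 <= X ->
  (lam - 1) * Rsum (lam_list lam N) (fun y => if cdec (Rabs y <= X) then Rabs y else 0)
    <= 2 * (lam * X).
Proof.
intros HX.
(* The bound by [2 * (lam * X)] does not survive adding a power below the cutoff [X]. The bound [G],
   independent of the cutoff, does, and it yields the claim at the step where [lam ^ N <= X]; powers
   above the cutoff add nothing. *)
assert (G : forall N, (lam - 1) * Rsum (lam_list lam N)
  (fun y => if cdec (Rabs y <= X) then Rabs y else 0) <= 2 * (lam ^ N - 1)).
{ clear N. induction N as [|N IH].
  - rewrite Rsum_lam_0, Rabs_R0. rewrite cdec_true by assumption. simpl; lra.
  - rewrite Rsum_lam_S, Rabs_Ropp. pose proof (pow_lt lam N ltac:(lra)) as Hp.
    rewrite Rabs_pos_eq by lra. rewrite <- tech_pow_Rmult.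
    case_cdec (lam ^ N <= X); nra. }
induction N as [|N IH].
- rewrite Rsum_lam_0, Rabs_R0. rewrite cdec_true by assumption. nra.
- rewrite Rsum_lam_S, Rabs_Ropp. pose proof (pow_lt lam N ltac:(lra)) as Hp.
  rewrite Rabs_pos_eq by lra.
  case_cdec (lam ^ N <= X); [|nra].
  specialize (G N). nra.
Qed.

(** The ratio is the one of [triad_comparable], in both directions; 0 is comparable only with
    itself. *)
Definition comparable (x y : R) : Prop :=
  (lam - 1) * Rabs y <= lam * Rabs x /\ (lam - 1) * Rabs x <= lam * Rabs y.

Lemma comparable_sym x y : comparable x y <-> comparable y x.
Proof. unfold comparable; tauto. Qed.

(** The value 1 at 0 keeps the weight positive, so that the Schur test can divide by it. *)
Definition wt (x : R) : R := if cdec (x = 0) then 1 else Rabs x.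

Lemma wt_pos x : 0 < wt x.
Proof. unfold wt. case_cdec (x = 0); [lra|now apply Rabs_pos_lt]. Qed.

(** The summand 1 serves the row of 0. The fraction is the geometric series of [lam_geom_sum], both
    signs counted, at the cutoff X = lam |x| / (lam - 1). *)
Definition schur_cst : R := 1 + 2 * lam ^ 2 / (lam - 1) ^ 2.

Lemma schur_cst_ge1 : 1 <= schur_cst.
Proof.
unfold schur_cst. assert (0 < 2 * lam ^ 2 / (lam - 1) ^ 2); [|lra].
apply Rdiv_lt_0_compat; apply Rmult_lt_0_compat; nra.
Qed.

Lemma comparable_wt_sum N x :
  Rsum (lam_list lam N) (fun y => if cdec (comparable x y) then wt y else 0)
    <= schur_cst * wt x.
Proof.
pose proof schur_cst_ge1 as K1.
destruct (classic (x = 0)) as [->|Hx].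
- unfold wt at 2. rewrite (cdec_true (0 = 0)) by auto.
  apply Rle_trans with (Rsum (lam_list lam N) (fun y => if cdec (y = 0) then 1 else 0)).
  + apply Rsum_le; intros y _. case_cdec (comparable 0 y).
    * assert (y = 0) as ->.
      { destruct H as [H _]. rewrite Rabs_R0 in H. pose proof (Rabs_pos y).
        apply NNPP; intros Hy. apply Rabs_pos_lt in Hy. nra. }
      unfold wt. rewrite !cdec_true by auto. lra.
    * case_cdec (y = 0); lra.
  + enough (Rsum (lam_list lam N) (fun y => if cdec (y = 0) then 1 else 0) = 1) by lra.
    induction N as [|N IH].
    * rewrite Rsum_lam_0, cdec_true; auto.
    * pose proof (pow_lt lam N ltac:(lra)).
      rewrite Rsum_lam_S, IH, !cdec_false by lra. ring.
- pose proof (Rabs_pos_lt x Hx) as Px.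
  unfold wt at 2. rewrite (cdec_false _ Hx).
  set (X := lam * Rabs x / (lam - 1)).
  assert (EX : (lam - 1) * X = lam * Rabs x) by (unfold X; field; lra).
  assert (PX : 0 <= X) by nra.
  apply Rle_trans with
    (Rsum (lam_list lam N) (fun y => if cdec (Rabs y <= X) then Rabs y else 0)).
  + apply Rsum_le; intros y _. case_cdec (comparable x y).
    * destruct H as [H1 H2]. unfold wt.
      case_cdec (y = 0). { subst y. rewrite Rabs_R0 in H2. nra. }
      rewrite cdec_true by nra. lra.
    * pose proof (Rabs_pos y). case_cdec (Rabs y <= X); lra.
  + pose proof (lam_geom_sum N X PX) as G.
    set (S := Rsum _ _) in *.
    apply Rmult_le_reg_l with ((lam - 1) ^ 2); [apply pow_lt; lra|].
    replace ((lam - 1) ^ 2 * (schur_cst * Rabs x))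
      with ((lam - 1) ^ 2 * Rabs x + 2 * lam * (lam * Rabs x))
      by (unfold schur_cst; field; lra).
    rewrite <- EX.
    apply (Rmult_le_compat_l (lam - 1)) in G; [|lra].
    pose proof (Rmult_le_pos _ _ (pow2_ge_0 (lam - 1)) (Rlt_le _ _ Px)).
    lra.
Qed.

(* Schur test with the weight [wt]: the relation [comparable] is symmetric and
   its weighted row sums are geometric series. *)
Lemma comparable_schur N f g :
  (forall x, 0 <= f x) -> (forall x, 0 <= g x) ->
  let L := lam_list lam N in
  Rsum L (fun x => Rsum L (fun y => if cdec (comparable x y) then f x * g y else 0))
    <= schur_cst * (l2 L f * l2 L g).
Proof.
intros Hf Hg L.
pose proof schur_cst_ge1 as K1.
assert (B : forall f, Rsum L (fun x => Rsum L (fun y =>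
    (if cdec (comparable x y) then f x * sqrt (wt y / wt x) else 0) ^ 2))
    <= (sqrt schur_cst * l2 L f) ^ 2).
{ clear f g Hf Hg. intros f. rewrite Rpow_mult_distr, l2_sqr, pow2_sqrt by lra.
  rewrite <- Rsum_scal. apply Rsum_le; intros x _.
  pose proof (wt_pos x) as Wx.
  rewrite (Rsum_ext _ _ (fun y => f x ^ 2 / wt x * (if cdec (comparable x y) then wt y else 0))).
  - rewrite Rsum_scal.
    replace (schur_cst * f x ^ 2) with (f x ^ 2 / wt x * (schur_cst * wt x)) by (field; lra).
    apply Rmult_le_compat_l; [|apply comparable_wt_sum].
    apply Rdiv_le_0_compat; auto using pow2_ge_0.
  - intros y. pose proof (wt_pos y) as Wy. case_cdec (comparable x y); [|ring].
    rewrite Rpow_mult_distr, pow2_sqrt; [field; lra|].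
    apply Rlt_le, Rdiv_lt_0_compat; auto. }
rewrite <- (sqrt_sqrt schur_cst) by lra.
replace (sqrt schur_cst * sqrt schur_cst * (l2 L f * l2 L g))
  with ((sqrt schur_cst * l2 L f) * (sqrt schur_cst * l2 L g)) by ring.
(* The two square roots multiply to 1. After Cauchy-Schwarz each factor is a weighted row sum
   bounded by [B], the second one after exchanging the sums. *)
rewrite (Rsum_ext _ _ (fun x => Rsum L (fun y =>
  (if cdec (comparable x y) then f x * sqrt (wt y / wt x) else 0) *
  (if cdec (comparable x y) then g y * sqrt (wt x / wt y) else 0)))).
- apply Rsum_CS2; try (apply Rmult_le_pos; [apply sqrt_pos|apply l2_nonneg]); [apply B|].
  rewrite Rsum_swap. eapply Rle_trans; [|apply (B g)].
  apply Req_le, Rsum_ext; intros y; apply Rsum_ext; intros x.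
  now rewrite (cdec_iff _ _ (comparable_sym x y)).
- intros x; apply Rsum_ext; intros y. case_cdec (comparable x y); [|ring].
  pose proof (wt_pos x) as Wx. pose proof (wt_pos y) as Wy.
  transitivity (f x * g y * (sqrt (wt y / wt x) * sqrt (wt x / wt y))); [|ring].
  rewrite <- sqrt_mult by (apply Rlt_le, Rdiv_lt_0_compat; auto).
  replace (wt y / wt x * (wt x / wt y)) with 1 by (field; lra).
  rewrite sqrt_1; ring.
Qed.

(** The pair x, y determines z, so [h z] may be replaced by [l2 L h]; what is left is the Schur
    bound for x, y. *)
Lemma triad_sum_comparable N f g h :
  (forall x, 0 <= f x) -> (forall x, 0 <= g x) -> (forall x, 0 <= h x) ->
  let L := lam_list lam N in
  Rsum L (fun x => Rsum L (fun y => Rsum L (fun z =>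
    if cdec (x + y + z = 0) then if cdec (comparable x y) then f x * g y * h z else 0 else 0)))
  <= schur_cst * (l2 L f * l2 L g * l2 L h).
Proof.
intros Hf Hg Hh L.
apply Rle_trans with (Rsum L (fun x => Rsum L (fun y =>
  l2 L h * (if cdec (comparable x y) then f x * g y else 0)))).
- apply Rsum_le; intros x _. apply Rsum_le; intros y _.
  case_cdec (comparable x y).
  + rewrite (Rsum_ext _ _ (fun z => f x * g y * (if cdec (x + y + z = 0) then h z else 0))).
    * rewrite Rsum_scal, (Rmult_comm (l2 L h)).
      apply Rmult_le_compat_l; [now apply Rmult_le_pos|].
      apply (Rsum_point_le L h (fun z => x + y + z = 0));
        [apply lam_list_NoDup|intros; lra|apply l2_nonneg|intros; now apply l2_ge_term].
    * intros z. case_cdec (x + y + z = 0); ring.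
  + rewrite (Rsum_ext _ _ (fun _ => 0)), Rsum_zero; [lra|].
    intros z. case_cdec (x + y + z = 0); ring.
- rewrite (Rsum_ext _ _ (fun x => l2 L h *
    Rsum L (fun y => if cdec (comparable x y) then f x * g y else 0)))
    by (intros; apply Rsum_scal).
  rewrite Rsum_scal.
  replace (schur_cst * (l2 L f * l2 L g * l2 L h))
    with (l2 L h * (schur_cst * (l2 L f * l2 L g))) by ring.
  apply Rmult_le_compat_l; [apply l2_nonneg|]. now apply comparable_schur.
Qed.

(** Every triad has a comparable pair: x and y if both are nonzero, otherwise z and the other one of
    x and y, which are opposite. The factor 3 counts the choices of the pair. *)
Lemma triad_sum_1d N f g h :
  (forall x, 0 <= f x) -> (forall x, 0 <= g x) -> (forall x, 0 <= h x) ->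
  let L := lam_list lam N in
  Rsum L (fun x => Rsum L (fun y => Rsum L (fun z =>
    if cdec (x + y + z = 0) then f x * g y * h z else 0)))
  <= 3 * schur_cst * (l2 L f * l2 L g * l2 L h).
Proof.
intros Hf Hg Hh L.
pose proof (triad_sum_comparable N f g h Hf Hg Hh) as B1.
pose proof (triad_sum_comparable N g h f Hg Hh Hf) as B2.
pose proof (triad_sum_comparable N f h g Hf Hh Hg) as B3.
cbv zeta in B1, B2, B3; fold L in B1, B2, B3.
set (t := fun x y z c => if cdec (x + y + z = 0)
   then if cdec c then f x * g y * h z else 0 else 0).
assert (S2 : Rsum L (fun x => Rsum L (fun y => Rsum L (fun z => t x y z (comparable y z))))
  <= schur_cst * (l2 L f * l2 L g * l2 L h)).
{ rewrite Rsum_swap.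
  rewrite (Rsum_ext _ _ (fun y => Rsum L (fun z => Rsum L (fun x => t x y z (comparable y z)))))
    by (intros; apply Rsum_swap).
  eapply Rle_trans; [|eapply Rle_trans; [apply B2|apply Req_le; ring]].
  apply Req_le, Rsum_ext; intros y; apply Rsum_ext; intros z; apply Rsum_ext; intros x.
  unfold t. rewrite (cdec_iff (x + y + z = 0) (y + z + x = 0)) by lra.
  case_cdec (y + z + x = 0); case_cdec (comparable y z); ring. }
assert (S3 : Rsum L (fun x => Rsum L (fun y => Rsum L (fun z => t x y z (comparable x z))))
  <= schur_cst * (l2 L f * l2 L g * l2 L h)).
{ rewrite (Rsum_ext _ _ (fun x => Rsum L (fun z => Rsum L (fun y => t x y z (comparable x z)))))
    by (intros; apply Rsum_swap).
  eapply Rle_trans; [|eapply Rle_trans; [apply B3|apply Req_le; ring]].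
  apply Req_le, Rsum_ext; intros x; apply Rsum_ext; intros z; apply Rsum_ext; intros y.
  unfold t. rewrite (cdec_iff (x + y + z = 0) (x + z + y = 0)) by lra.
  case_cdec (x + z + y = 0); case_cdec (comparable x z); ring. }
apply Rle_trans with (Rsum L (fun x => Rsum L (fun y => Rsum L (fun z => t x y z (comparable x y))))
  + Rsum L (fun x => Rsum L (fun y => Rsum L (fun z => t x y z (comparable y z))))
  + Rsum L (fun x => Rsum L (fun y => Rsum L (fun z => t x y z (comparable x z)))));
  [|unfold t at 1; lra].
rewrite <- !Rsum_plus. apply Rsum_le; intros x Hx.
rewrite <- !Rsum_plus. apply Rsum_le; intros y Hy.
rewrite <- !Rsum_plus. apply Rsum_le; intros z Hz.
unfold t. case_cdec (x + y + z = 0); [|lra].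
pose proof (Rmult_le_pos _ _ (Rmult_le_pos _ _ (Hf x) (Hg y)) (Hh z)) as P.
assert (C : comparable x y \/ comparable y z \/ comparable x z).
{ destruct (classic (x = 0)) as [->|Hx0]; [|destruct (classic (y = 0)) as [->|Hy0]].
  - right; left. assert (z = - y) as -> by lra. unfold comparable. rewrite Rabs_Ropp.
    pose proof (Rabs_pos y). nra.
  - right; right. assert (z = - x) as -> by lra. unfold comparable. rewrite Rabs_Ropp.
    pose proof (Rabs_pos x). nra.
  - left; split; [apply (triad_comparable N x y z)|apply (triad_comparable N y x z)]; auto; lra. }
case_cdec (comparable x y); case_cdec (comparable y z); case_cdec (comparable x z); try lra.
tauto.
Qed.

End Lattice.

(** * Sums over boxes and triads *)

Definition upd (k : wvec) (d : nat) (x : R) : wvec := fun j => if Nat.eqb j d then x else k j.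

Lemma upd_same k d x : upd k d x d = x.
Proof. unfold upd. now rewrite Nat.eqb_refl. Qed.

Lemma upd_lt k d x j : (j < d)%nat -> upd k d x j = k j.
Proof. intros H. unfold upd. now rewrite (proj2 (Nat.eqb_neq j d)) by lia. Qed.

Lemma forall_lt_S (P : nat -> Prop) d :
  (forall j, (j < S d)%nat -> P j) <-> (forall j, (j < d)%nat -> P j) /\ P d.
Proof.
split; [intros H; split; intros; apply H; lia|].
intros [H1 H2] j Hj. destruct (Nat.eq_dec j d) as [->|]; auto. apply H1; lia.
Qed.

Lemma forall_upd (P : nat -> R -> Prop) k d x :
  (forall j, (j < S d)%nat -> P j (upd k d x j)) <->
  (forall j, (j < d)%nat -> P j (k j)) /\ P d x.
Proof.
rewrite forall_lt_S, upd_same.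
split; (intros [H1 H2]; split; auto); intros j Hj; specialize (H1 j Hj);
  rewrite upd_lt in *; auto.
Qed.

Lemma Rsum_box_S lam N d F :
  Rsum (box lam N (S d)) F =
  Rsum (box lam N d) (fun k => Rsum (lam_list lam N) (fun x => F (upd k d x))).
Proof.
cbn [box]. rewrite Rsum_flat_map. apply Rsum_ext; intros k. now rewrite Rsum_map.
Qed.

Lemma box_In lam N d k : In k (box lam N d) ->
  (forall j, (j < d)%nat -> In (k j) (lam_list lam N)) /\ (forall j, (d <= j)%nat -> k j = 0).
Proof.
revert k; induction d as [|d IH]; intros k; cbn [box].
- intros [<-|[]]. split; [lia|auto].
- intros H. apply in_flat_map in H. destruct H as [k' [Hk' H]].
  apply in_map_iff in H. destruct H as [x [<- Hx]]. apply IH in Hk'. destruct Hk' as [H1 H2].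
  split.
  + now apply (forall_upd (fun _ y => In y (lam_list lam N)) k' d x).
  + intros j Hj. rewrite (proj2 (Nat.eqb_neq j d)) by lia. apply H2; lia.
Qed.

Lemma box_inLamd lam N d k : In k (box lam N d) -> inLamd lam d k.
Proof.
intros H. destruct (box_In _ _ _ _ H) as [H1 H2]. split; auto.
intros j Hj. destruct (lam_list_In _ _ _ (H1 j Hj)) as [->|[n [_ Hn]]]; [left|right]; eauto.
Qed.

Lemma inLamd_vneg lam d k : inLamd lam d k -> inLamd lam d (vneg k).
Proof.
unfold vneg; intros [H1 H2]. split; intros j Hj.
- destruct (H1 j Hj) as [->|[n [-> | ->]]]; [left; ring|right; exists n; auto|right; exists n; left; ring].
- rewrite H2; auto; ring.
Qed.

Lemma Rsum_box_vneg lam N d F : Rsum (box lam N d) (fun k => F (vneg k)) = Rsum (box lam N d) F.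
Proof.
revert F; induction d as [|d IH]; intros F.
- simpl. f_equal. f_equal. apply functional_extensionality; intros j. unfold vneg. ring.
- rewrite !Rsum_box_S, <- IH. apply Rsum_ext; intros k.
  rewrite <- Rsum_lam_opp. apply Rsum_ext; intros x. f_equal.
  apply functional_extensionality; intros j. unfold vneg, upd. destruct (Nat.eqb j d); ring.
Qed.

Definition triad (d : nat) (p q r : wvec) : Prop :=
  forall j, (j < d)%nat -> p j + q j + r j = 0.

Lemma triad_upd d p q r x y z :
  triad (S d) (upd p d x) (upd q d y) (upd r d z) <-> triad d p q r /\ x + y + z = 0.
Proof.
unfold triad. rewrite forall_lt_S, !upd_same.
split; (intros [H1 H2]; split; auto); intros j Hj; specialize (H1 j Hj);
  rewrite !upd_lt in *; auto.
Qed.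

(** With the symmetric convention p + q + r = 0 this is a truncated convolution at [vneg r], and the
    three members of a triad can be permuted freely. *)
Definition pair_sum (lam : R) (d M : nat) (r : wvec) (f : wvec -> wvec -> R) : R :=
  Rsum (box lam M d) (fun p => Rsum (box lam M d) (fun q =>
    if cdec (triad d p q r) then f p q else 0)).

Definition triad_sum (lam : R) (d M : nat) (f : wvec -> wvec -> wvec -> R) : R :=
  Rsum (box lam M d) (fun r => pair_sum lam d M r (fun p q => f p q r)).

Lemma triad_swap12 d p q r : triad d p q r <-> triad d q p r.
Proof. unfold triad; split; intros H j Hj; specialize (H j Hj); lra. Qed.

Lemma triad_swap23 d p q r : triad d p q r <-> triad d p r q.
Proof. unfold triad; split; intros H j Hj; specialize (H j Hj); lra. Qed.

Lemma pair_sum_ext lam d M r f g :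
  (forall p q, In p (box lam M d) -> In q (box lam M d) -> triad d p q r -> f p q = g p q) ->
  pair_sum lam d M r f = pair_sum lam d M r g.
Proof.
intros H. unfold pair_sum. apply Rsum_ext_in; intros p Hp. apply Rsum_ext_in; intros q Hq.
case_cdec (triad d p q r); auto.
Qed.

Lemma pair_sum_le lam d M r f g :
  (forall p q, In p (box lam M d) -> In q (box lam M d) -> triad d p q r -> f p q <= g p q) ->
  pair_sum lam d M r f <= pair_sum lam d M r g.
Proof.
intros H. unfold pair_sum. apply Rsum_le; intros p Hp. apply Rsum_le; intros q Hq.
case_cdec (triad d p q r); auto; lra.
Qed.

Lemma pair_sum_plus lam d M r f g :
  pair_sum lam d M r (fun p q => f p q + g p q) = pair_sum lam d M r f + pair_sum lam d M r g.
Proof.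
unfold pair_sum. rewrite <- Rsum_plus. apply Rsum_ext; intros p.
rewrite <- Rsum_plus. apply Rsum_ext; intros q. case_cdec (triad d p q r); ring.
Qed.

Lemma pair_sum_minus lam d M r f g :
  pair_sum lam d M r (fun p q => f p q - g p q) = pair_sum lam d M r f - pair_sum lam d M r g.
Proof.
unfold pair_sum. rewrite <- Rsum_minus. apply Rsum_ext; intros p.
rewrite <- Rsum_minus. apply Rsum_ext; intros q. case_cdec (triad d p q r); ring.
Qed.

Lemma pair_sum_scal lam d M r c f :
  pair_sum lam d M r (fun p q => c * f p q) = c * pair_sum lam d M r f.
Proof.
unfold pair_sum. rewrite <- Rsum_scal. apply Rsum_ext; intros p.
rewrite <- Rsum_scal. apply Rsum_ext; intros q. case_cdec (triad d p q r); ring.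
Qed.

Lemma pair_sum_Rabs lam d M r f :
  Rabs (pair_sum lam d M r f) <= pair_sum lam d M r (fun p q => Rabs (f p q)).
Proof.
unfold pair_sum. eapply Rle_trans; [apply Rsum_Rabs|]. apply Rsum_le; intros p _.
eapply Rle_trans; [apply Rsum_Rabs|]. apply Rsum_le; intros q _.
case_cdec (triad d p q r); [|rewrite Rabs_R0]; lra.
Qed.

Lemma pair_sum_swap lam d M r f :
  pair_sum lam d M r (fun p q => f q p) = pair_sum lam d M r f.
Proof.
unfold pair_sum. rewrite Rsum_swap. apply Rsum_ext; intros p; apply Rsum_ext; intros q.
now rewrite (cdec_iff _ _ (triad_swap12 d q p r)).
Qed.

Lemma pair_sum_nonneg lam d M r f :
  (forall p q, In p (box lam M d) -> In q (box lam M d) -> 0 <= f p q) ->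
  0 <= pair_sum lam d M r f.
Proof.
intros H. unfold pair_sum. apply Rsum_nonneg; intros p Hp. apply Rsum_nonneg; intros q Hq.
case_cdec (triad d p q r); auto; lra.
Qed.

Lemma triad_sum_ext lam d M f g :
  (forall p q r, In p (box lam M d) -> In q (box lam M d) -> In r (box lam M d) ->
     triad d p q r -> f p q r = g p q r) ->
  triad_sum lam d M f = triad_sum lam d M g.
Proof. intros H. apply Rsum_ext_in; intros r Hr. apply pair_sum_ext; auto. Qed.

Lemma triad_sum_plus lam d M f g :
  triad_sum lam d M (fun p q r => f p q r + g p q r) = triad_sum lam d M f + triad_sum lam d M g.
Proof. unfold triad_sum. rewrite <- Rsum_plus. apply Rsum_ext; intros; apply pair_sum_plus. Qed.

Lemma triad_sum_scal lam d M c f :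
  triad_sum lam d M (fun p q r => c * f p q r) = c * triad_sum lam d M f.
Proof. unfold triad_sum. rewrite <- Rsum_scal. apply Rsum_ext; intros; apply pair_sum_scal. Qed.

Lemma triad_sum_zero lam d M : triad_sum lam d M (fun _ _ _ => 0) = 0.
Proof.
pose proof (triad_sum_scal lam d M 0 (fun _ _ _ => 0)) as E.
rewrite Rmult_0_l in E. etransitivity; [|exact E].
apply triad_sum_ext; intros; ring.
Qed.

Lemma triad_sum_swap12 lam d M f :
  triad_sum lam d M (fun p q r => f q p r) = triad_sum lam d M f.
Proof.
apply Rsum_ext; intros r. apply (pair_sum_swap lam d M r (fun p q => f p q r)).
Qed.

Lemma triad_sum_swap23 lam d M f :
  triad_sum lam d M (fun p q r => f p r q) = triad_sum lam d M f.
Proof.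
unfold triad_sum, pair_sum. rewrite Rsum_swap. symmetry. rewrite Rsum_swap.
apply Rsum_ext; intros p. rewrite Rsum_swap.
apply Rsum_ext; intros q. apply Rsum_ext; intros r.
now rewrite (cdec_iff _ _ (triad_swap23 d p q r)).
Qed.

Lemma triad_sum_antisym12 lam d M f :
  (forall p q r, In p (box lam M d) -> In q (box lam M d) -> In r (box lam M d) ->
     triad d p q r -> f p q r + f q p r = 0) ->
  triad_sum lam d M f = 0.
Proof.
intros H.
pose proof (triad_sum_plus lam d M f (fun p q r => f q p r)) as E.
rewrite (triad_sum_swap12 lam d M f) in E.
cbv beta in E. rewrite (triad_sum_ext _ _ _ _ _ H), triad_sum_zero in E. lra.
Qed.

Lemma triad_sum_antisym23 lam d M f :
  (forall p q r, In p (box lam M d) -> In q (box lam M d) -> In r (box lam M d) ->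
     triad d p q r -> f p q r + f p r q = 0) ->
  triad_sum lam d M f = 0.
Proof.
intros H.
pose proof (triad_sum_plus lam d M f (fun p q r => f p r q)) as E.
rewrite (triad_sum_swap23 lam d M f) in E.
cbv beta in E. rewrite (triad_sum_ext _ _ _ _ _ H), triad_sum_zero in E. lra.
Qed.

(** Moves the last coordinates of the three vectors to the innermost sums, where the one-dimensional
    bound applies with the other coordinates frozen. *)
Lemma Rsum_interleave {A B} (l : list A) (l' : list B) F :
  Rsum l (fun a => Rsum l' (fun x => Rsum l (fun b => Rsum l' (fun y =>
    Rsum l (fun c => Rsum l' (fun z => F a b c x y z)))))) =
  Rsum l (fun a => Rsum l (fun b => Rsum l (fun c =>
    Rsum l' (fun x => Rsum l' (fun y => Rsum l' (fun z => F a b c x y z)))))).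
Proof.
apply Rsum_ext; intros a. rewrite Rsum_swap. apply Rsum_ext; intros b.
rewrite Rsum_swap.
rewrite (Rsum_ext l' _ (fun y => Rsum l (fun c => Rsum l' (fun x => Rsum l' (F a b c x y)))))
  by (intros; apply Rsum_swap).
rewrite Rsum_swap. apply Rsum_ext; intros c. now rewrite Rsum_swap.
Qed.

Lemma l2_box_S lam N d F :
  l2 (box lam N (S d)) F = l2 (box lam N d) (fun k => l2 (lam_list lam N) (fun x => F (upd k d x))).
Proof.
unfold l2 at 1 2. f_equal. rewrite Rsum_box_S. apply Rsum_ext; intros k. now rewrite l2_sqr.
Qed.

Section Box.
Variable lam : R.
Hypothesis lam_gt1 : 1 < lam.

(** Induction on the dimension: for fixed leading coordinates [triad_sum_1d] bounds the sum over the
    last ones by the l^2 norms [F'], [G'], [H'] along the fibres, and the l^2 norm of [F'] over the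
    smaller box is that of [F]. *)
Lemma triad_sum_bound d N F G H :
  (forall p, 0 <= F p) -> (forall p, 0 <= G p) -> (forall p, 0 <= H p) ->
  triad_sum lam d N (fun p q r => F p * G q * H r) <=
  (3 * schur_cst lam) ^ d * (l2 (box lam N d) F * l2 (box lam N d) G * l2 (box lam N d) H).
Proof.
pose proof (schur_cst_ge1 lam lam_gt1) as K1.
revert F G H; induction d as [|d IH]; intros F G H HF HG HH.
- unfold triad_sum, pair_sum, l2; simpl.
  rewrite !Rplus_0_r, !Rmult_1_r, !sqrt_square by auto.
  rewrite cdec_true by (intros j Hj; lia). lra.
- set (L := lam_list lam N).
  set (F' := fun k => l2 L (fun x => F (upd k d x))).
  set (G' := fun k => l2 L (fun x => G (upd k d x))).
  set (H' := fun k => l2 L (fun x => H (upd k d x))).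
  apply Rle_trans with
    (triad_sum lam d N (fun p q r => 3 * schur_cst lam * (F' p * G' q * H' r))).
  + unfold triad_sum at 1, pair_sum. rewrite Rsum_box_S.
    rewrite (Rsum_ext _ _ (fun r => Rsum L (fun z =>
      Rsum (box lam N d) (fun p => Rsum L (fun x =>
      Rsum (box lam N d) (fun q => Rsum L (fun y =>
        if cdec (triad d p q r /\ x + y + z = 0)
        then F (upd p d x) * G (upd q d y) * H (upd r d z) else 0))))))).
    2:{ intros r. apply Rsum_ext; intros z. rewrite Rsum_box_S.
        apply Rsum_ext; intros p. apply Rsum_ext; intros x. rewrite Rsum_box_S.
        apply Rsum_ext; intros q. apply Rsum_ext; intros y.
        now rewrite (cdec_iff _ _ (triad_upd d p q r x y z)). }
    rewrite (Rsum_interleave (box lam N d) L (fun r p q z x y =>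
      if cdec (triad d p q r /\ x + y + z = 0)
      then F (upd p d x) * G (upd q d y) * H (upd r d z) else 0)).
    unfold triad_sum, pair_sum.
    apply Rsum_le; intros r _; apply Rsum_le; intros p _; apply Rsum_le; intros q _.
    case_cdec (triad d p q r).
    * rewrite Rsum_swap.
      eapply Rle_trans; [|apply (triad_sum_1d lam lam_gt1 N (fun x => F (upd p d x))
        (fun y => G (upd q d y)) (fun z => H (upd r d z))); auto].
      apply Req_le. apply Rsum_ext; intros x. rewrite Rsum_swap.
      apply Rsum_ext; intros y. apply Rsum_ext; intros z.
      now rewrite (cdec_iff (triad d p q r /\ x + y + z = 0) (x + y + z = 0)) by tauto.
    * apply Req_le. apply Rsum_eq0; intros z; apply Rsum_eq0; intros x; apply Rsum_eq0; intros y.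
      now rewrite cdec_false by tauto.
  + rewrite triad_sum_scal, !l2_box_S. fold L.
    rewrite <- tech_pow_Rmult, (Rmult_assoc (3 * schur_cst lam)).
    apply Rmult_le_compat_l; [lra|].
    apply IH; intros; apply l2_nonneg.
Qed.

(** Truncation by size: [lam ^ N] is the first power left out of [lam_list lam N], so on a larger
    box this predicate is the indicator of box N. *)
Definition inbox (d N : nat) (p : wvec) : Prop := forall j, (j < d)%nat -> Rabs (p j) < lam ^ N.

Lemma box_inbox d N p : In p (box lam N d) -> inbox d N p.
Proof. intros H j Hj. apply lam_list_lt; auto. now apply (box_In _ _ _ _ H). Qed.

Lemma Rsum_lam_restrict N M F : (N <= M)%nat ->
  Rsum (lam_list lam M) (fun x => if cdec (Rabs x < lam ^ N) then F x else 0) =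
  Rsum (lam_list lam N) F.
Proof.
induction 1 as [|M HM IH].
- apply Rsum_ext_in; intros x Hx. now rewrite cdec_true by now apply lam_list_lt.
- rewrite Rsum_lam_S, IH, Rabs_Ropp.
  pose proof (pow_lt lam M ltac:(lra)).
  assert (lam ^ N <= lam ^ M) by (apply Rle_pow; [lra|lia]).
  rewrite Rabs_pos_eq, cdec_false by lra. ring.
Qed.

Lemma Rsum_box_restrict d N M F : (N <= M)%nat ->
  Rsum (box lam M d) (fun p => if cdec (inbox d N p) then F p else 0) = Rsum (box lam N d) F.
Proof.
intros HM. revert F; induction d as [|d IH]; intros F.
- simpl. rewrite cdec_true by (intros j Hj; lia). ring.
- rewrite !Rsum_box_S. rewrite <- IH. apply Rsum_ext; intros k.
  rewrite (Rsum_ext _ _ (fun x => if cdec (inbox d N k)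
    then (if cdec (Rabs x < lam ^ N) then F (upd k d x) else 0) else 0)).
  + rewrite Rsum_if, Rsum_lam_restrict; auto.
  + intros x.
    rewrite (cdec_iff (inbox (S d) N (upd k d x)) (inbox d N k /\ Rabs x < lam ^ N))
      by apply (forall_upd (fun _ y => Rabs y < lam ^ N)).
    case_cdec (inbox d N k); case_cdec (Rabs x < lam ^ N);
      [rewrite cdec_true|rewrite cdec_false|rewrite cdec_false|rewrite cdec_false]; tauto.
Qed.

Lemma Rsum_box_mono d N M F : (N <= M)%nat -> (forall p, In p (box lam M d) -> 0 <= F p) ->
  Rsum (box lam N d) F <= Rsum (box lam M d) F.
Proof.
intros HM HF. rewrite <- (Rsum_box_restrict d N M F HM). apply Rsum_le; intros p Hp.
case_cdec (inbox d N p); [lra|auto].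
Qed.

Lemma Rsum_box_diff d N M f g : (N <= M)%nat ->
  (forall p, In p (box lam M d) -> Rabs (f p) <= g p) ->
  Rabs (Rsum (box lam M d) f - Rsum (box lam N d) f) <=
  Rsum (box lam M d) g - Rsum (box lam N d) g.
Proof.
intros HM H.
rewrite <- (Rsum_box_restrict d N M f HM), <- (Rsum_box_restrict d N M g HM), <- !Rsum_minus.
eapply Rle_trans; [apply Rsum_Rabs|]. apply Rsum_le; intros p Hp.
specialize (H p Hp). pose proof (Rabs_pos (f p)).
case_cdec (inbox d N p); [replace (f p - f p) with 0 by ring; rewrite Rabs_R0; lra|].
rewrite !Rminus_0_r; lra.
Qed.

Lemma pair_sum_restrict d N M r f : (N <= M)%nat ->
  pair_sum lam d M r (fun p q => if cdec (inbox d N p /\ inbox d N q) then f p q else 0) =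
  pair_sum lam d N r f.
Proof.
intros HM. unfold pair_sum.
rewrite <- (Rsum_box_restrict d N M (fun p => Rsum (box lam N d) _) HM).
apply Rsum_ext; intros p.
rewrite <- (Rsum_box_restrict d N M (fun q => if cdec (triad d p q r) then _ else _) HM).
rewrite <- Rsum_if. apply Rsum_ext; intros q.
case_cdec (inbox d N p /\ inbox d N q).
- now rewrite (cdec_true (inbox d N p)), (cdec_true (inbox d N q)) by tauto.
- case_cdec (inbox d N p); case_cdec (inbox d N q);
    case_cdec (triad d p q r); tauto.
Qed.

Lemma pair_sum_diff d N M r f g : (N <= M)%nat ->
  (forall p q, In p (box lam M d) -> In q (box lam M d) -> triad d p q r ->
     ~ (inbox d N p /\ inbox d N q) -> Rabs (f p q) <= g p q) ->
  Rabs (pair_sum lam d M r f - pair_sum lam d N r f) <=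
  pair_sum lam d M r g - pair_sum lam d N r g.
Proof.
intros HM H.
rewrite <- (pair_sum_restrict d N M r f HM), <- (pair_sum_restrict d N M r g HM),
  <- !pair_sum_minus.
eapply Rle_trans; [apply pair_sum_Rabs|]. apply pair_sum_le; intros p q Hp Hq T.
case_cdec (inbox d N p /\ inbox d N q).
- replace (f p q - f p q) with 0 by ring. rewrite Rabs_R0; lra.
- rewrite !Rminus_0_r; auto.
Qed.

Lemma pair_sum_mono d N M r f : (N <= M)%nat ->
  (forall p q, In p (box lam M d) -> In q (box lam M d) -> 0 <= f p q) ->
  pair_sum lam d N r f <= pair_sum lam d M r f.
Proof.
intros HM H. rewrite <- (pair_sum_restrict d N M r f HM). apply pair_sum_le; intros p q Hp Hq _.
case_cdec (inbox d N p /\ inbox d N q); [lra|auto].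
Qed.

(** Both [t] and [s + t] are nondecreasing and bounded above, hence convergent, and [s] is their
    difference. *)
Lemma ex_finite_lim_seq_dominated (s t : nat -> R) B :
  (forall n, Rabs (s (S n) - s n) <= t (S n) - t n) -> (forall n, t n <= B) ->
  ex_finite_lim_seq s.
Proof.
intros H HB.
assert (Hs : forall n, s n - s 0%nat <= t n - t 0%nat).
{ induction n as [|n IH]; [lra|]. specialize (H n). pose proof (Rle_abs (s (S n) - s n)). lra. }
destruct (ex_finite_lim_seq_incr t B) as [lt Ht]; auto.
{ intros n. specialize (H n). pose proof (Rabs_pos (s (S n) - s n)). lra. }
destruct (ex_finite_lim_seq_incr (fun n => s n + t n) (s 0%nat - t 0%nat + 2 * B)) as [ls Hs'].
{ intros n. specialize (H n). pose proof (Rle_abs (- (s (S n) - s n))) as A.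
  rewrite Rabs_Ropp in A. lra. }
{ intros n. specialize (Hs n). specialize (HB n). lra. }
exists (ls - lt). apply is_lim_seq_ext with (fun n => (s n + t n) - t n); [intros; ring|].
now apply is_lim_seq_minus'.
Qed.

(* The cubic form of the truncation vanishes, so what the truncated balance at
   level [N] misses is the part of the sum over triads leaving box [N], a tail
   of the convergent sum of [Maj]. *)
Lemma flux_lim0 d (tau Maj : wvec -> wvec -> wvec -> R) (D : wvec -> R) B :
  (forall p q r, 0 <= Maj p q r) ->
  (forall M, triad_sum lam d M Maj <= B) ->
  (forall N M p q r, In r (box lam N d) -> In p (box lam M d) -> In q (box lam M d) ->
     triad d p q r -> ~ (inbox d N p /\ inbox d N q) -> Rabs (tau p q r) <= Maj p q r) ->
  (forall N, triad_sum lam d N tau = 0) ->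
  (forall N r, In r (box lam N d) ->
     is_lim_seq (fun M => pair_sum lam d M r (fun p q => tau p q r)) (D r)) ->
  is_lim_seq (fun N => Rsum (box lam N d) D) 0.
Proof.
intros HMaj HB Hdom H0 HD.
assert (Mono : forall N M, (N <= M)%nat -> triad_sum lam d N Maj <= triad_sum lam d M Maj).
{ intros N M HM. unfold triad_sum at 2.
  eapply Rle_trans; [|apply (Rsum_box_mono d N M _ HM); intros; apply pair_sum_nonneg; auto].
  apply Rsum_le; intros r _. apply (pair_sum_mono d N M); auto. }
destruct (ex_finite_lim_seq_incr (fun M => triad_sum lam d M Maj) B) as [l Hl]; auto.
(* Keep N fixed, subtract the vanishing sum of [tau] over box N and let M grow. Terms with p and q
   in box N cancel, and the others are bounded by the sum of [Maj] at level M minus that at level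
   N. *)
assert (Bd : forall N, Rabs (Rsum (box lam N d) D) <= l - triad_sum lam d N Maj).
{ intros N.
  assert (HL : is_lim_seq (fun M => Rsum (box lam N d)
    (fun r => pair_sum lam d M r (fun p q => tau p q r))) (Rsum (box lam N d) D)).
  { specialize (HD N). revert HD. generalize (box lam N d) as bx.
    induction bx as [|r bx IH]; intros HD; simpl; [apply is_lim_seq_const|].
    apply is_lim_seq_plus'; [apply HD|apply IH; intros; apply HD]; simpl; auto. }
  apply (is_lim_seq_incr_n _ N) in HL. apply is_lim_seq_abs in HL.
  apply (is_lim_seq_incr_n _ N) in Hl.
  refine (is_lim_seq_le _ _ _ _ _ HL
    (is_lim_seq_minus' _ _ _ _ Hl (is_lim_seq_const (triad_sum lam d N Maj)))).
  intros k. set (M := (k + N)%nat). assert (HM : (N <= M)%nat) by (unfold M; lia).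
  rewrite <- (Rminus_0_r (Rsum _ _)), <- (H0 N) at 1.
  unfold triad_sum at 1. rewrite <- Rsum_minus.
  apply Rle_trans with (Rsum (box lam N d) (fun r =>
    pair_sum lam d M r (fun p q => Maj p q r) - pair_sum lam d N r (fun p q => Maj p q r))).
  - eapply Rle_trans; [apply Rsum_Rabs|]. apply Rsum_le; intros r Hr.
    apply pair_sum_diff; auto. intros p q Hp Hq. now apply (Hdom N M).
  (* Letting r range over box M instead of box N only adds nonnegative terms. *)
  - rewrite Rsum_minus. unfold triad_sum.
    apply Rplus_le_compat_r. apply Rsum_box_mono; auto.
    intros; apply pair_sum_nonneg; auto. }
apply is_lim_seq_abs_0.
apply is_lim_seq_le_le with (fun _ => 0) (fun N => l - triad_sum lam d N Maj).
- intros N; split; [apply Rabs_pos|apply Bd].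
- apply is_lim_seq_const.
- replace 0 with (l - l) by ring. apply is_lim_seq_minus'; [apply is_lim_seq_const|exact Hl].
Qed.

End Box.

(** * Convergence of the convolution *)

Lemma lam_list_mono lam N M x : (N <= M)%nat -> In x (lam_list lam N) -> In x (lam_list lam M).
Proof.
intros HM. induction HM as [|M HM IH]; auto.
intros H. rewrite lam_list_S. apply in_or_app. auto.
Qed.

Lemma box_intro lam N d k :
  (forall j, (j < d)%nat -> In (k j) (lam_list lam N)) -> (forall j, (d <= j)%nat -> k j = 0) ->
  In k (box lam N d).
Proof.
revert k; induction d as [|d IH]; intros k H1 H2; cbn [box].
- left. apply functional_extensionality; intros j. rewrite H2; auto; lia.
- apply in_flat_map. exists (upd k d 0). split.
  + apply IH; intros j Hj; [rewrite upd_lt; auto|].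
    destruct (Nat.eq_dec j d) as [->|]; [apply upd_same|].
    unfold upd. rewrite (proj2 (Nat.eqb_neq j d)) by lia. apply H2; lia.
  + apply in_map_iff. exists (k d). split; [|apply H1; lia].
    apply functional_extensionality; intros j. unfold upd.
    destruct (Nat.eqb_spec j d) as [->|]; auto.
Qed.

Lemma box_mono_In lam N M d k : (N <= M)%nat -> In k (box lam N d) -> In k (box lam M d).
Proof.
intros HM H. destruct (box_In _ _ _ _ H) as [H1 H2].
apply box_intro; auto. intros j Hj. now apply (lam_list_mono lam N M), H1.
Qed.

Lemma is_lim_seq_Rsum {A} (l : list A) (s : A -> nat -> R) (L : A -> R) :
  (forall a, In a l -> is_lim_seq (s a) (L a)) ->
  is_lim_seq (fun n => Rsum l (fun a => s a n)) (Rsum l L).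
Proof.
induction l as [|a l IH]; intros H; simpl; [apply is_lim_seq_const|].
apply is_lim_seq_plus'; [apply H|apply IH; intros; apply H]; simpl; auto.
Qed.

Lemma Re_Csum {A} (l : list A) F : Re (Csum l F) = Rsum l (fun a => Re (F a)).
Proof.
induction l as [|a l IH]; [reflexivity|].
change (Re (F a) + Re (Csum l F) = Rsum (a :: l) (fun a => Re (F a))). now rewrite IH.
Qed.

Lemma Im_Csum {A} (l : list A) F : Im (Csum l F) = Rsum l (fun a => Im (F a)).
Proof.
induction l as [|a l IH]; [reflexivity|].
change (Im (F a) + Im (Csum l F) = Rsum (a :: l) (fun a => Im (F a))). now rewrite IH.
Qed.

Lemma Csum_ext_in {A} (l : list A) F G :
  (forall a, In a l -> F a = G a) -> Csum l F = Csum l G.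
Proof.
induction l as [|a l IH]; simpl; intros H; auto.
rewrite H by auto. f_equal; auto.
Qed.

Lemma Cmod_Csum {A} (l : list A) F : Cmod (Csum l F) <= Rsum l (fun a => Cmod (F a)).
Proof.
induction l as [|a l IH]; simpl; [rewrite Cmod_0; lra|].
eapply Rle_trans; [apply Cmod_triangle|]. lra.
Qed.

Lemma Cmod_Csum_le d F B : (forall i, (i < d)%nat -> Cmod (F i) <= B) ->
  Cmod (Csum (seq 0 d) F) <= INR d * B.
Proof.
intros H. eapply Rle_trans; [apply Cmod_Csum|].
apply Rle_trans with (Rsum (seq 0 d) (fun _ => B)).
- apply Rsum_le; intros i Hi. apply in_seq in Hi. apply H; lia.
- apply Req_le. clear. generalize 0%nat. induction d as [|d IH]; intros s.
  + simpl; ring.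
  + rewrite S_INR. cbn [seq]. simpl Rsum. rewrite IH. ring.
Qed.

Lemma Re_Csum2_mult d (c : nat -> nat -> C) (z : nat -> C) :
  Re (Csum (seq 0 d) (fun i => Cmult (Csum (seq 0 d) (fun j => c i j)) (z i))) =
  Rsum (seq 0 d) (fun i => Rsum (seq 0 d) (fun j =>
    Re (z i) * Re (c i j) + - Im (z i) * Im (c i j))).
Proof.
rewrite Re_Csum. apply Rsum_ext; intros i.
rewrite Rsum_plus, (Rsum_scal _ (Re (z i))), (Rsum_scal _ (- Im (z i))), <- Re_Csum, <- Im_Csum.
destruct (Csum (seq 0 d) (fun j => c i j)), (z i). unfold Cmult, Re, Im; simpl; ring.
Qed.

Lemma pair_sum_Rsum {A} lam d M r (l : list A) f :
  pair_sum lam d M r (fun p q => Rsum l (fun a => f a p q)) =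
  Rsum l (fun a => pair_sum lam d M r (f a)).
Proof.
induction l as [|a l IH]; simpl.
- transitivity (pair_sum lam d M r (fun _ _ => 0 * 0)); [apply pair_sum_ext; intros; ring|].
  rewrite (pair_sum_scal lam d M r 0 (fun _ _ => 0)). ring.
- rewrite pair_sum_plus, IH. reflexivity.
Qed.

Definition nrm2 (d : nat) (x : nat -> C) : R := Rsum (seq 0 d) (fun i => Cmod (x i) ^ 2).

Lemma nrm2_nonneg d x : 0 <= nrm2 d x.
Proof. apply Rsum_sqr_nonneg. Qed.

Lemma knorm2_Rsum d k : knorm2 d k = Rsum (seq 0 d) (fun j => k j ^ 2).
Proof.
unfold knorm2, Rsum. induction (seq 0 d) as [|j l IH]; [auto|].
simpl in *. now rewrite IH.
Qed.

Lemma knorm2_nonneg d k : 0 <= knorm2 d k.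
Proof. rewrite knorm2_Rsum. apply Rsum_sqr_nonneg. Qed.

Lemma Rsum_seq_ge_term d F i : (i < d)%nat -> (forall j, 0 <= F j) -> F i <= Rsum (seq 0 d) F.
Proof. intros Hi HF. apply Rsum_ge_term; auto. apply in_seq; lia. Qed.

Lemma knorm2_ge d k j : (j < d)%nat -> k j ^ 2 <= knorm2 d k.
Proof.
intros Hj. rewrite knorm2_Rsum.
apply (Rsum_seq_ge_term d (fun j => k j ^ 2)); auto using pow2_ge_0.
Qed.

Lemma nrm2_ge d x i : (i < d)%nat -> Cmod (x i) ^ 2 <= nrm2 d x.
Proof.
intros Hi. apply (Rsum_seq_ge_term d (fun j => Cmod (x j) ^ 2)); auto.
intros; apply pow2_ge_0.
Qed.

Lemma box_zero lam N d k : In k (box lam N d) -> ~ vnonzero d k -> k = (fun _ => 0).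
Proof.
intros H Hz. destruct (box_In _ _ _ _ H) as [_ H2].
apply functional_extensionality; intros j. destruct (le_lt_dec d j); auto.
apply NNPP; intros Hj. apply Hz. exists j; auto.
Qed.

Lemma knorm2_zero d : knorm2 d (fun _ => 0) = 0.
Proof. rewrite knorm2_Rsum. apply Rsum_eq0; intros; ring. Qed.

(** The sequence F(k) = |k| |u(k)|, whose squares sum to the square of the h^1 norm. *)
Definition amp (d : nat) (u : vfield) (k : wvec) : R :=
  sqrt (knorm2 d k * nrm2 d (fun i => u i k)).

Lemma amp_nonneg d u k : 0 <= amp d u k.
Proof. apply sqrt_pos. Qed.

Lemma amp_sqr d u k : amp d u k ^ 2 = knorm2 d k * nrm2 d (fun i => u i k).
Proof.
unfold amp. rewrite pow2_sqrt; auto. apply Rmult_le_pos; [apply knorm2_nonneg|apply nrm2_nonneg].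
Qed.

Lemma pow2_le_le a b : 0 <= b -> a ^ 2 <= b ^ 2 -> a <= b.
Proof. intros. apply Rsqr_incr_0_var; auto. now rewrite !Rsqr_pow2. Qed.

Lemma amp_deriv d u k i j : (i < d)%nat -> (j < d)%nat -> Rabs (k j) * Cmod (u i k) <= amp d u k.
Proof.
intros Hi Hj. apply pow2_le_le; [apply amp_nonneg|].
rewrite amp_sqr, Rpow_mult_distr, RPow_abs, Rabs_pos_eq by apply pow2_ge_0.
apply Rmult_le_compat; auto using pow2_ge_0, knorm2_ge.
- now apply (nrm2_ge d (fun i => u i k)).
Qed.

Section Amp.
Variable lam : R.
Hypothesis lam_gt1 : 1 < lam.

(** The exponents of the lattice start at 0, so a nonzero coordinate has modulus at least 1. This is
    what lets higher powers of |k| dominate lower ones. *)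
Lemma knorm2_ge1 N d k : In k (box lam N d) -> vnonzero d k -> 1 <= knorm2 d k.
Proof.
intros H [j [Hj Hk]]. destruct (box_In _ _ _ _ H) as [H1 _].
destruct (lam_list_Rabs lam lam_gt1 N (k j) (H1 j Hj)) as [E|[n [_ E]]]; [tauto|].
apply Rle_trans with (k j ^ 2); [|now apply knorm2_ge].
rewrite <- (Rabs_pos_eq (k j ^ 2)), <- RPow_abs, E by apply pow2_ge_0.
rewrite <- (pow1 2). apply pow_incr; split; [lra|apply pow_R1_Rle; lra].
Qed.

Lemma amp_ge N d u k i : In k (box lam N d) -> (forall i, (i < d)%nat -> u i (fun _ => 0) = RtoC 0) ->
  (i < d)%nat -> Cmod (u i k) <= amp d u k.
Proof.
intros H H0 Hi. destruct (classic (vnonzero d k)) as [Hz|Hz].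
- apply pow2_le_le; [apply amp_nonneg|]. rewrite amp_sqr.
  pose proof (knorm2_ge1 N d k H Hz). pose proof (nrm2_ge d (fun i => u i k) i Hi) as E.
  cbv beta in E. pose proof (pow2_ge_0 (Cmod (u i k))). nra.
- rewrite (box_zero _ _ _ _ H Hz), H0, Cmod_0 by auto. apply amp_nonneg.
Qed.

Lemma amp_sum N d m u : (1 <= m)%nat ->
  Rsum (box lam N d) (fun k => amp d u k ^ 2) <= hm_partial lam d m u N.
Proof.
intros Hm. apply Rsum_le; intros k Hk. rewrite amp_sqr.
case_cdec (vnonzero d k).
- apply Rmult_le_compat_r; [apply nrm2_nonneg|].
  pose proof (knorm2_ge1 N d k Hk H). rewrite <- (pow_1 (knorm2 d k)) at 1.
  now apply Rle_pow.
- rewrite (box_zero _ _ _ _ Hk H), knorm2_zero. lra.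
Qed.

Lemma Rsum_box_point N d r :
  Rsum (box lam N d) (fun k => if cdec (forall j, (j < d)%nat -> k j = r j) then 1 else 0) <= 1.
Proof.
induction d as [|d IH].
- simpl. rewrite cdec_true by (intros; lia). lra.
- rewrite Rsum_box_S. eapply Rle_trans; [|apply IH]. apply Rsum_le; intros k _.
  rewrite (Rsum_ext _ _ (fun x => if cdec (forall j, (j < d)%nat -> k j = r j)
    then if cdec (x = r d) then 1 else 0 else 0)).
  + rewrite Rsum_if. case_cdec (forall j, (j < d)%nat -> k j = r j); [|lra].
    apply (Rsum_point_le _ (fun _ => 1)); try lra; [now apply lam_list_NoDup|congruence|].
    intros; lra.
  + intros x. rewrite (cdec_iff _ _ (forall_upd (fun j y => y = r j) k d x)).
    case_cdec (forall j, (j < d)%nat -> k j = r j); case_cdec (x = r d);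
      [rewrite cdec_true|rewrite cdec_false|rewrite cdec_false|rewrite cdec_false]; tauto.
Qed.

(** A pair sum at a fixed r is one slice of a triad sum whose third factor is the indicator [dl] of
    r, of l^2 norm at most 1. Passing to the box of size [max N M] ensures that r itself is among
    the summands. *)
Lemma pair_sum_bound d N M r F B :
  (forall p, 0 <= F p) -> (forall M, Rsum (box lam M d) (fun p => F p ^ 2) <= B) ->
  In r (box lam N d) ->
  pair_sum lam d M r (fun p q => F p * F q) <= (3 * schur_cst lam) ^ d * B.
Proof.
intros HF HB Hr.
pose proof (schur_cst_ge1 lam lam_gt1) as K1.
set (M' := max N M).
apply Rle_trans with (pair_sum lam d M' r (fun p q => F p * F q)).
{ apply pair_sum_mono; auto; [lia|]. intros; now apply Rmult_le_pos. }
set (dl := fun k : wvec => if cdec (forall j, (j < d)%nat -> k j = r j) then 1 else 0).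
assert (Hdl : forall k, 0 <= dl k)
  by (intros k; unfold dl; case_cdec (forall j, (j < d)%nat -> k j = r j); lra).
apply Rle_trans with (triad_sum lam d M' (fun p q r => F p * F q * dl r)).
{ apply Rle_trans with (pair_sum lam d M' r (fun p q => F p * F q * dl r)).
  - apply pair_sum_le; intros p q _ _ _. unfold dl. rewrite cdec_true by auto. lra.
  - apply (Rsum_ge_term (box lam M' d) (fun r => pair_sum lam d M' r (fun p q => F p * F q * dl r))).
    + apply (box_mono_In lam N); auto. unfold M'; lia.
    + intros r' _. apply pair_sum_nonneg; intros. apply Rmult_le_pos; auto. now apply Rmult_le_pos. }
eapply Rle_trans; [now apply triad_sum_bound|].
apply Rmult_le_compat_l; [apply pow_le; lra|].
rewrite <- (Rmult_1_r B). apply Rmult_le_compat; try apply l2_nonneg.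
- apply Rmult_le_pos; apply l2_nonneg.
- specialize (HB M'). rewrite <- l2_sqr in HB. lra.
- apply pow2_le_le; [lra|]. rewrite l2_sqr, pow1.
  eapply Rle_trans; [|apply (Rsum_box_point M' d r)].
  apply Req_le, Rsum_ext; intros k. unfold dl.
  case_cdec (forall j, (j < d)%nat -> k j = r j); ring.
Qed.

Lemma pair_sum_cv d N r F B f :
  (forall p, 0 <= F p) -> (forall M, Rsum (box lam M d) (fun p => F p ^ 2) <= B) ->
  In r (box lam N d) ->
  (forall M p q, In p (box lam M d) -> In q (box lam M d) -> Rabs (f p q) <= F p * F q) ->
  ex_finite_lim_seq (fun M => pair_sum lam d M r f).
Proof.
intros HF HB Hr Hf.
apply ex_finite_lim_seq_dominated with (t := fun M => pair_sum lam d M r (fun p q => F p * F q))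
  (B := (3 * schur_cst lam) ^ d * B).
- intros M. apply pair_sum_diff; auto. intros p q Hp Hq _ _. now apply (Hf (S M)).
- intros M. now apply (pair_sum_bound d N).
Qed.

Lemma amp_triad_bound d N u B :
  (forall M, Rsum (box lam M d) (fun p => amp d u p ^ 2) <= B) ->
  triad_sum lam d N (fun p q r => amp d u p * amp d u q * amp d u r) <=
  (3 * schur_cst lam) ^ d * (sqrt B * sqrt B * sqrt B).
Proof.
intros HB. pose proof (schur_cst_ge1 lam lam_gt1) as K1.
eapply Rle_trans; [apply triad_sum_bound; auto using amp_nonneg|].
apply Rmult_le_compat_l; [apply pow_le; lra|].
assert (l2 (box lam N d) (amp d u) <= sqrt B) by apply sqrt_le_1_alt, HB.
pose proof (l2_nonneg (box lam N d) (amp d u)).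
repeat apply Rmult_le_compat; auto. now apply Rmult_le_pos.
Qed.

Lemma is_lim_seq_real s : ex_finite_lim_seq s -> is_lim_seq s (real (Lim_seq s)).
Proof. intros [l Hl]. now rewrite (is_lim_seq_unique _ _ Hl). Qed.

Lemma vsum_eq_triad d p q r : vsum_eq d p q (vneg r) <-> triad d p q r.
Proof. unfold vsum_eq, triad, vneg; split; intros H j Hj; specialize (H j Hj); lra. Qed.

(** [Clim] takes [real (Lim_seq _)] of each part, which is the limit of the double sums only if that
    limit is finite; domination by [F p * F q] provides this. *)
Lemma conv_lim d N r f g F B :
  (forall p, 0 <= F p) -> (forall M, Rsum (box lam M d) (fun p => F p ^ 2) <= B) ->
  In r (box lam N d) ->
  (forall M p, In p (box lam M d) -> Cmod (f p) <= F p /\ Cmod (g p) <= F p) ->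
  is_lim_seq (fun M => pair_sum lam d M r (fun p q => Re (Cmult (f p) (g q))))
    (Re (conv lam d f g (vneg r))) /\
  is_lim_seq (fun M => pair_sum lam d M r (fun p q => Im (Cmult (f p) (g q))))
    (Im (conv lam d f g (vneg r))).
Proof.
intros HF HB Hr Hfg.
assert (Hm : forall M p q, In p (box lam M d) -> In q (box lam M d) ->
  Cmod (Cmult (f p) (g q)) <= F p * F q).
{ intros M p q Hp Hq. rewrite Cmod_mult.
  apply Rmult_le_compat; try apply Cmod_ge_0; [now apply (Hfg M)|now apply (Hfg M)]. }
split.
- match goal with |- is_lim_seq ?s _ => assert (Hex : ex_finite_lim_seq s) end.
  { apply (pair_sum_cv d N r F B); auto. intros M p q Hp Hq.
    eapply Rle_trans; [apply re_le_Cmod|now apply (Hm M)]. }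
  apply is_lim_seq_real in Hex. unfold conv, Clim; simpl Re.
  erewrite Lim_seq_ext; [exact Hex|]. intros M. cbv beta. unfold pair_sum.
  rewrite Re_Csum. apply Rsum_ext; intros p. rewrite Re_Csum. apply Rsum_ext; intros q.
  rewrite (cdec_iff _ _ (vsum_eq_triad d p q r)). case_cdec (triad d p q r); auto.
- match goal with |- is_lim_seq ?s _ => assert (Hex : ex_finite_lim_seq s) end.
  { apply (pair_sum_cv d N r F B); auto. intros M p q Hp Hq.
    eapply Rle_trans; [|now apply (Hm M)]. eapply Rle_trans; [|apply Rmax_Cmod]. apply Rmax_r. }
  apply is_lim_seq_real in Hex. unfold conv, Clim; simpl Im.
  erewrite Lim_seq_ext; [exact Hex|]. intros M. cbv beta. unfold pair_sum.
  rewrite Im_Csum. apply Rsum_ext; intros p. rewrite Im_Csum. apply Rsum_ext; intros q.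
  rewrite (cdec_iff _ _ (vsum_eq_triad d p q r)). case_cdec (triad d p q r); auto.
Qed.

End Amp.

Lemma Csum_plus {A} (l : list A) F G :
  Csum l (fun a => Cplus (F a) (G a)) = Cplus (Csum l F) (Csum l G).
Proof. induction l as [|a l IH]; simpl; [|rewrite IH]; ring. Qed.

Lemma Csum_scal {A} (l : list A) c F : Csum l (fun a => Cmult c (F a)) = Cmult c (Csum l F).
Proof. induction l as [|a l IH]; simpl; [|rewrite IH]; ring. Qed.

Lemma Csum_conj {A} (l : list A) F : Csum l (fun a => Cconj (F a)) = Cconj (Csum l F).
Proof.
induction l as [|a l IH]; simpl; [|rewrite IH, Cplus_conj; auto].
unfold Cconj, RtoC; simpl. now rewrite Ropp_0.
Qed.

Lemma Csum_eq0 {A} (l : list A) F : (forall a, In a l -> F a = RtoC 0) -> Csum l F = RtoC 0.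
Proof.
induction l as [|a l IH]; simpl; intros H; auto.
rewrite H, IH by auto. ring.
Qed.

Lemma Cmod_Ci : Cmod Ci = 1.
Proof.
unfold Cmod, Ci; simpl. replace (0 * (0 * 1) + 1 * (1 * 1)) with 1 by ring. apply sqrt_1.
Qed.

Lemma Cmod_dpart j f k : Cmod (dpart j f k) = Rabs (k j) * Cmod (f k).
Proof. unfold dpart. rewrite !Cmod_mult, Cmod_Ci, Cmod_R. ring. Qed.

Lemma Cconj_RtoC x : Cconj (RtoC x) = RtoC x.
Proof. unfold Cconj, RtoC; simpl. now rewrite Ropp_0. Qed.

Lemma Cconj_Ci : Cconj Ci = Copp Ci.
Proof. unfold Cconj, Ci, Copp; simpl. f_equal; ring. Qed.

(** The contribution of one triad to the pairing of the advection term with [Z]. The pairing at -r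
    conjugates Z(-r), which is Z(r) for a real field; hence no conjugate. *)
Definition transfer (d : nat) (u Z : vfield) (p q r : wvec) : R :=
  Re (Csum (seq 0 d) (fun i =>
    Cmult (Csum (seq 0 d) (fun j => Cmult (u j p) (dpart j (u i) q))) (Z i r))).

(** * Flux balance at a fixed time *)

Record admissible_field (lam : R) (d : nat) (B : R) (u : vfield) : Prop := {
  field_real : forall i, (i < d)%nat -> real_sfield lam d (u i);
  field_mean0 : forall i, (i < d)%nat -> u i (fun _ => 0) = RtoC 0;
  field_div0 : forall k, inLamd lam d k -> divergence d u k = RtoC 0;
  field_amp : forall N, Rsum (box lam N d) (fun k => amp d u k ^ 2) <= B }.

Lemma field_dot0 lam d B u k : admissible_field lam d B u -> inLamd lam d k ->
  Csum (seq 0 d) (fun i => Cmult (RtoC (k i)) (u i k)) = RtoC 0.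
Proof.
intros Hu Hk. pose proof (field_div0 _ _ _ _ Hu k Hk) as H.
unfold divergence, dpart in H.
transitivity (Cmult (Copp Ci) (RtoC 0)); [|ring]. rewrite <- H, <- Csum_scal.
apply Csum_ext_in; intros i _.
transitivity (Cmult (Copp (Cmult Ci Ci)) (Cmult (RtoC (k i)) (u i k))); [|ring].
replace (Copp (Cmult Ci Ci)) with (RtoC 1); [ring|].
unfold Ci, Cmult, Copp, RtoC; simpl. f_equal; ring.
Qed.

Section Field.
Variables (lam : R) (d : nat) (B : R) (u : vfield).
Hypothesis lam_gt1 : 1 < lam.
Hypothesis Hu : admissible_field lam d B u.

Lemma field_le N k i : In k (box lam N d) -> (i < d)%nat -> Cmod (u i k) <= amp d u k.
Proof. intros Hk Hi. apply (amp_ge lam lam_gt1 N); auto. apply (field_mean0 _ _ _ _ Hu). Qed.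

Lemma transfer_le Z N p q r c :
  In p (box lam N d) -> In q (box lam N d) ->
  (forall i, (i < d)%nat -> Cmod (Z i r) <= c * amp d u r) ->
  Rabs (transfer d u Z p q r) <= INR d * INR d * c * (amp d u p * amp d u q * amp d u r).
Proof.
intros Hp Hq HZ. unfold transfer. eapply Rle_trans; [apply re_le_Cmod|].
replace (INR d * INR d * c * (amp d u p * amp d u q * amp d u r))
  with (INR d * ((INR d * (amp d u p * amp d u q)) * (c * amp d u r))) by ring.
apply Cmod_Csum_le; intros i Hi. rewrite Cmod_mult.
apply Rmult_le_compat; try apply Cmod_ge_0; auto.
apply Cmod_Csum_le; intros j Hj. rewrite Cmod_mult, Cmod_dpart.
apply Rmult_le_compat; try apply Cmod_ge_0.
- apply Rmult_le_pos; [apply Rabs_pos|apply Cmod_ge_0].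
- now apply (field_le N).
- now apply amp_deriv.
Qed.

Lemma transfer_lim Z N r : In r (box lam N d) ->
  is_lim_seq (fun M => pair_sum lam d M r (fun p q => transfer d u Z p q r))
    (Re (Csum (seq 0 d) (fun i => Cmult (advect lam d u i (vneg r)) (Z i r)))).
Proof.
intros Hr. unfold advect. rewrite Re_Csum2_mult.
apply is_lim_seq_ext with (fun M => Rsum (seq 0 d) (fun i => Rsum (seq 0 d) (fun j =>
  Re (Z i r) * pair_sum lam d M r (fun p q => Re (Cmult (u j p) (dpart j (u i) q)))
  + - Im (Z i r) * pair_sum lam d M r (fun p q => Im (Cmult (u j p) (dpart j (u i) q)))))).
- intros M. symmetry. etransitivity.
  { apply pair_sum_ext; intros p q _ _ _. apply Re_Csum2_mult. }
  rewrite pair_sum_Rsum. apply Rsum_ext; intros i.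
  rewrite pair_sum_Rsum. apply Rsum_ext; intros j.
  now rewrite pair_sum_plus, !pair_sum_scal.
- apply is_lim_seq_Rsum; intros i Hi. apply is_lim_seq_Rsum; intros j Hj.
  apply in_seq in Hi; apply in_seq in Hj.
  destruct (conv_lim lam lam_gt1 d N r (u j) (dpart j (u i)) (amp d u) B) as [L1 L2]; auto.
  + apply amp_nonneg.
  + apply (field_amp _ _ _ _ Hu).
  + intros M p Hp. split; [apply (field_le M); auto; lia|].
    rewrite Cmod_dpart. apply amp_deriv; lia.
  + apply is_lim_seq_plus'; apply is_lim_seq_mult'; auto; apply is_lim_seq_const.
Qed.

(** The substitution k = -r turns the conjugate of Z(k) into Z(r), against which the gradient
    vanishes. At k = 0, where no equation is imposed, Z itself is zero. *)
Lemma balance_transfer (Z v : vfield) (P : sfield) N :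
  (forall k, inLamd lam d k -> vnonzero d k -> forall i, (i < d)%nat ->
     Cplus (v i k) (advect lam d u i k) = Copp (grad P i k)) ->
  (forall i, (i < d)%nat -> real_sfield lam d (Z i)) ->
  (forall i, (i < d)%nat -> Z i (fun _ => 0) = RtoC 0) ->
  (forall k, inLamd lam d k -> Csum (seq 0 d) (fun i => Cmult (RtoC (k i)) (Z i k)) = RtoC 0) ->
  Rsum (box lam N d) (fun k => Re (Csum (seq 0 d) (fun i => Cmult (v i k) (Cconj (Z i k))))) =
  - Rsum (box lam N d)
      (fun r => Re (Csum (seq 0 d) (fun i => Cmult (advect lam d u i (vneg r)) (Z i r)))).
Proof.
intros Heq HZr HZ0 HZd. rewrite <- Rsum_box_vneg.
transitivity (-1 * Rsum (box lam N d)
  (fun r => Re (Csum (seq 0 d) (fun i => Cmult (advect lam d u i (vneg r)) (Z i r)))));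
  [|ring].
rewrite <- Rsum_scal. apply Rsum_ext_in; intros r Hr.
pose proof (box_inLamd _ _ _ _ Hr) as Lr.
destruct (classic (vnonzero d r)) as [Hz|Hz].
- assert (Hz' : vnonzero d (vneg r)).
  { destruct Hz as [j [Hj Hr0]]. exists j; split; auto. unfold vneg; lra. }
  pose proof (inLamd_vneg _ _ _ Lr) as Lr'.
  rewrite (Csum_ext_in _ _ (fun i => Cplus (Cmult (RtoC (-1)) (Cmult (advect lam d u i (vneg r)) (Z i r)))
    (Cmult (Cmult Ci (P (vneg r))) (Cmult (RtoC (r i)) (Z i r))))).
  + rewrite Csum_plus, !Csum_scal, (HZd r Lr).
    match goal with |- _ = _ * Re ?X => set (S := X) end.
    destruct S as [a b]. unfold Cplus, Cmult, RtoC, Re; simpl. ring.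
  + intros i Hi. apply in_seq in Hi.
    rewrite (HZr i) by (auto; lia). rewrite Cconj_conj.
    specialize (Heq _ Lr' Hz' i ltac:(lia)).
    replace (v i (vneg r)) with
      (Cplus (Cplus (v i (vneg r)) (advect lam d u i (vneg r))) (Copp (advect lam d u i (vneg r))))
      by ring.
    rewrite Heq. unfold grad, dpart, vneg at 1. rewrite !RtoC_opp. ring.
- rewrite (box_zero _ _ _ _ Hr Hz).
  replace (vneg (fun _ => 0)) with (fun _ : nat => 0)
    by (apply functional_extensionality; intros; unfold vneg; ring).
  rewrite !Csum_eq0; [simpl; ring| |]; intros i Hi; apply in_seq in Hi;
    rewrite HZ0, ?Cconj_RtoC by lia; ring.
Qed.

(** The density [tau] may differ from [transfer] as long as both have the same sum over p, q at
    fixed r. The enstrophy needs this freedom: its flux has a good form only after symmetrisation in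
    p and q. *)
Lemma balance_lim0 (Z v : vfield) (P : sfield) (tau : wvec -> wvec -> wvec -> R) c :
  (forall k, inLamd lam d k -> vnonzero d k -> forall i, (i < d)%nat ->
     Cplus (v i k) (advect lam d u i k) = Copp (grad P i k)) ->
  (forall i, (i < d)%nat -> real_sfield lam d (Z i)) ->
  (forall i, (i < d)%nat -> Z i (fun _ => 0) = RtoC 0) ->
  (forall k, inLamd lam d k -> Csum (seq 0 d) (fun i => Cmult (RtoC (k i)) (Z i k)) = RtoC 0) ->
  0 <= c ->
  (forall M r, inLamd lam d r ->
     pair_sum lam d M r (fun p q => transfer d u Z p q r) =
     pair_sum lam d M r (fun p q => tau p q r)) ->
  (forall N M p q r, In r (box lam N d) -> In p (box lam M d) -> In q (box lam M d) ->
     triad d p q r -> ~ (inbox lam d N p /\ inbox lam d N q) ->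
     Rabs (tau p q r) <= c * (amp d u p * amp d u q * amp d u r)) ->
  (forall N, triad_sum lam d N tau = 0) ->
  is_lim_seq (fun N => Rsum (box lam N d)
    (fun k => Re (Csum (seq 0 d) (fun i => Cmult (v i k) (Cconj (Z i k)))))) 0.
Proof.
intros Heq HZr HZ0 HZd Hc Htau Hle H0.
apply is_lim_seq_ext with (fun N => - Rsum (box lam N d)
  (fun r => Re (Csum (seq 0 d) (fun i => Cmult (advect lam d u i (vneg r)) (Z i r))))).
{ intros N. symmetry. now apply (balance_transfer Z v P N). }
replace (Finite 0) with (Rbar_opp 0) by (simpl; f_equal; ring).
apply -> is_lim_seq_opp.
refine (flux_lim0 lam lam_gt1 d tau (fun p q r => c * (amp d u p * amp d u q * amp d u r)) _
  (c * ((3 * schur_cst lam) ^ d * (sqrt B * sqrt B * sqrt B))) _ _ Hle H0 _).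
- intros. apply Rmult_le_pos; auto. repeat apply Rmult_le_pos; apply amp_nonneg.
- intros M. rewrite triad_sum_scal. apply Rmult_le_compat_l; auto.
  apply amp_triad_bound; auto. apply (field_amp _ _ _ _ Hu).
- intros N r Hr. eapply is_lim_seq_ext; [intros M; apply Htau; now apply (box_inLamd lam N)|].
  now apply (transfer_lim Z N).
Qed.

End Field.

(** * Triad antisymmetries and the balances of energy, helicity and enstrophy *)

Ltac unfold_csum := unfold Csum in *; cbn [fold_right seq] in *.

(** The shape of the antisymmetries: the sum of the two terms is a multiple [c] of a divergence [z],
    an identity that [ring] can check before [z = 0] is used. *)
Lemma Re_eq0 a b c z : z = RtoC 0 -> Cplus a b = Cmult c z -> Re a + Re b = 0.
Proof.
intros -> H. change (Re a + Re b) with (Re (Cplus a b)). rewrite H.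
unfold Re, Cmult, RtoC; simpl. ring.
Qed.

Lemma triad_RtoC d p q r j : triad d p q r -> (j < d)%nat ->
  RtoC (r j) = Copp (Cplus (RtoC (p j)) (RtoC (q j))).
Proof.
intros T Hj. specialize (T j Hj). rewrite <- RtoC_plus, <- RtoC_opp. f_equal. lra.
Qed.

Definition momentum_equation (lam : R) (d : nat) (u v : vfield) (P : sfield) : Prop :=
  forall k, inLamd lam d k -> vnonzero d k -> forall i, (i < d)%nat ->
    Cplus (v i k) (advect lam d u i k) = Copp (grad P i k).

Lemma energy_balance lam d B u v P :
  1 < lam -> d = 2%nat \/ d = 3%nat -> admissible_field lam d B u ->
  momentum_equation lam d u v P ->
  is_lim_seq (fun N => Rsum (box lam N d)
    (fun k => Re (Csum (seq 0 d) (fun i => Cmult (v i k) (Cconj (u i k)))))) 0.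
Proof.
intros lam_gt1 Hd Hu Heq.
apply (balance_lim0 lam d B u lam_gt1 Hu u v P (transfer d u u) (INR d * INR d * 1)); auto.
- apply (field_real _ _ _ _ Hu).
- apply (field_mean0 _ _ _ _ Hu).
- intros k Hk. now apply (field_dot0 lam d B).
- pose proof (pos_INR d). repeat apply Rmult_le_pos; lra.
- intros N M p q r Hr Hp Hq _ _. apply (transfer_le lam d B u lam_gt1 Hu u M); auto.
  intros i Hi. rewrite Rmult_1_l. now apply (field_le lam d B u lam_gt1 Hu N).
(* Adding the term with q and r exchanged gives i u(p).(q + r) u(q).u(r) = -i (p.u(p)) u(q).u(r),
   which incompressibility annihilates. *)
- intros N. apply triad_sum_antisym23. intros p q r Hp _ _ T.
  apply box_inLamd in Hp. pose proof (field_dot0 lam d B u p Hu Hp) as D.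
  apply Re_eq0 with (c := Cmult (Copp Ci)
    (Csum (seq 0 d) (fun i => Cmult (u i q) (u i r)))) (2 := D ) || idtac.
  eapply Re_eq0 with (1 := D).
  instantiate (1 := Cmult (Copp Ci) (Csum (seq 0 d) (fun i => Cmult (u i q) (u i r)))).
  pose proof (triad_RtoC d p q r) as E. unfold dpart.
  destruct Hd as [-> | ->]; unfold_csum;
    rewrite !(E 0%nat), !(E 1%nat), ?(E 2%nat) by (auto; lia); ring.
Qed.

Lemma vort3_real lam u : (forall i, (i < 3)%nat -> real_sfield lam 3 (u i)) ->
  forall i, (i < 3)%nat -> real_sfield lam 3 (vort3 u i).
Proof.
intros Hu i Hi k Hk.
pose proof (Hu 0%nat ltac:(lia) k Hk) as E0. pose proof (Hu 1%nat ltac:(lia) k Hk) as E1.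
pose proof (Hu 2%nat ltac:(lia) k Hk) as E2.
destruct i as [|[|[|i]]]; [| | |lia]; cbn [vort3];
  rewrite Cmult_conj, Cminus_conj, !Cmult_conj, !Cconj_RtoC, Cconj_Ci, ?E0, ?E1, ?E2;
  unfold vneg; rewrite !RtoC_opp; ring.
Qed.

Lemma vort3_zero u : forall i, vort3 u i (fun _ => 0) = RtoC 0.
Proof. intros [|[|[|i]]]; cbn [vort3]; auto; ring. Qed.

Lemma vort3_dot0 u k : Csum (seq 0 3) (fun i => Cmult (RtoC (k i)) (vort3 u i k)) = RtoC 0.
Proof. unfold_csum. cbn [vort3]. ring. Qed.

Lemma Cmod_cross a b x y A : Rabs a * Cmod x <= A -> Rabs b * Cmod y <= A ->
  Cmod (Cmult Ci (Cminus (Cmult (RtoC a) x) (Cmult (RtoC b) y))) <= 2 * A.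
Proof.
intros H1 H2. rewrite Cmod_mult, Cmod_Ci, Rmult_1_l. unfold Cminus.
eapply Rle_trans; [apply Cmod_triangle|].
rewrite Cmod_opp, !Cmod_mult, !Cmod_R. lra.
Qed.

Lemma Cmod_vort3 u k i : (i < 3)%nat -> Cmod (vort3 u i k) <= 2 * amp 3 u k.
Proof.
intros Hi. destruct i as [|[|[|i]]]; [| | |lia]; cbn [vort3]; apply Cmod_cross;
  apply amp_deriv; lia.
Qed.

Lemma Cmod_vort2 u k : Cmod (vort2 u k) <= 2 * amp 2 u k.
Proof. apply Cmod_cross; apply amp_deriv; lia. Qed.

(* Lamb form: up to a gradient, which does not see the divergence-free vorticity,
   the symmetrised advection term is the sum of the two cross products
   [omega(p) x u(q)] and [omega(q) x u(p)]. *)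
Definition lamb (u : vfield) (p q r : wvec) : R :=
  let w := vort3 u in
  Re (Csum (seq 0 3) (fun i => match i with
    | 0%nat => Cmult (Cminus (Cmult (w 1%nat p) (u 2%nat q)) (Cmult (w 2%nat p) (u 1%nat q))) (w 0%nat r)
    | 1%nat => Cmult (Cminus (Cmult (w 2%nat p) (u 0%nat q)) (Cmult (w 0%nat p) (u 2%nat q))) (w 1%nat r)
    | _ => Cmult (Cminus (Cmult (w 0%nat p) (u 1%nat q)) (Cmult (w 1%nat p) (u 0%nat q))) (w 2%nat r)
    end)).

(** A scalar triple product changes sign when its two vorticity factors, at p and r, are
    exchanged. *)
Lemma lamb_antisym u p q r : lamb u p q r + lamb u r q p = 0.
Proof.
unfold lamb. eapply Re_eq0 with (c := RtoC 0) (1 := eq_refl). unfold_csum. ring.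
Qed.

Lemma Re_plus_eq a b c e : Cplus a b = Cplus c e -> Re a + Re b = Re c + Re e.
Proof.
intros H. change (Re (Cplus a b) = Re (Cplus c e)). now rewrite H.
Qed.

(** By the double cross product formula, i (u(p).q) u(q) is w(q) x u(p) plus i q (u(p).u(q)), where
    w is the vorticity. The symmetrised gradient part is -i r (u(p).u(q)), orthogonal to w(r) = i r
    x u(r). *)
Lemma transfer_lamb u p q r : triad 3 p q r ->
  transfer 3 u (vort3 u) p q r + transfer 3 u (vort3 u) q p r = lamb u p q r + lamb u q p r.
Proof.
intros T. unfold transfer, lamb. apply Re_plus_eq. unfold dpart. unfold_csum. cbn [vort3].
rewrite !(triad_RtoC 3 p q r 0), !(triad_RtoC 3 p q r 1), !(triad_RtoC 3 p q r 2) by (auto; lia).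
ring.
Qed.

Lemma helicity_balance lam B u v P :
  1 < lam -> admissible_field lam 3 B u -> momentum_equation lam 3 u v P ->
  is_lim_seq (fun N => Rsum (box lam N 3)
    (fun k => Re (Csum (seq 0 3) (fun i => Cmult (v i k) (Cconj (vort3 u i k)))))) 0.
Proof.
intros lam_gt1 Hu Heq.
apply (balance_lim0 lam 3 B u lam_gt1 Hu (vort3 u) v P (transfer 3 u (vort3 u))
  (INR 3 * INR 3 * 2)); auto.
- apply vort3_real, (field_real _ _ _ _ Hu).
- intros; apply vort3_zero.
- intros; apply vort3_dot0.
- simpl; lra.
- intros N M p q r Hr Hp Hq _ _. apply (transfer_le lam 3 B u lam_gt1 Hu (vort3 u) M); auto.
  intros i Hi. now apply Cmod_vort3.
- intros N.
  assert (L : triad_sum lam 3 N (lamb u) = 0).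
  (* The antisymmetry of [lamb] exchanges its first and third arguments; swapping the last two turns
     it into one in the first two. *)
  { rewrite <- (triad_sum_swap23 lam 3 N (lamb u)). apply triad_sum_antisym12.
    intros; apply lamb_antisym. }
  pose proof (triad_sum_plus lam 3 N (lamb u) (fun p q r => lamb u q p r)) as E.
  rewrite (triad_sum_swap12 lam 3 N (lamb u)), L in E.
  pose proof (triad_sum_plus lam 3 N (transfer 3 u (vort3 u))
    (fun p q r => transfer 3 u (vort3 u) q p r)) as E'.
  rewrite (triad_sum_swap12 lam 3 N (transfer 3 u (vort3 u))) in E'.
  rewrite (triad_sum_ext lam 3 N _ (fun p q r => lamb u p q r + lamb u q p r)) in E'
    by (intros; now apply transfer_lamb).
  lra.
Qed.

(* [enst_dual u] represents the form [v |-> (vort2 v, vort2 u)]. *)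
Definition enst_dual (u : vfield) : vfield := fun i k =>
  match i with
  | 0%nat => Cmult Ci (Cmult (RtoC (k 1%nat)) (vort2 u k))
  | 1%nat => Copp (Cmult Ci (Cmult (RtoC (k 0%nat)) (vort2 u k)))
  | _ => RtoC 0
  end.

Lemma enst_dual_spec u v k :
  Cmult (vort2 v k) (Cconj (vort2 u k)) =
  Csum (seq 0 2) (fun i => Cmult (v i k) (Cconj (enst_dual u i k))).
Proof.
unfold_csum. cbn [enst_dual].
rewrite Copp_conj, !Cmult_conj, !Cconj_RtoC, Cconj_Ci. unfold vort2 at 1. ring.
Qed.

(** The triad term of the transport of vorticity, (u . grad omega, omega). *)
Definition enst_transfer (u : vfield) (p q r : wvec) : R :=
  Re (Cmult Ci (Cmult (Csum (seq 0 2) (fun j => Cmult (u j p) (RtoC (q j))))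
    (Cmult (vort2 u q) (vort2 u r)))).

(* The difference of the two transfers is antisymmetric in [p] and [q]: this is
   the absence of vortex stretching in the plane. *)
Lemma enst_transfer_pair lam B u M r : admissible_field lam 2 B u ->
  pair_sum lam 2 M r (fun p q => transfer 2 u (enst_dual u) p q r) =
  pair_sum lam 2 M r (fun p q => enst_transfer u p q r).
Proof.
intros Hu. apply Rminus_diag_uniq.
set (f := fun p q => transfer 2 u (enst_dual u) p q r - enst_transfer u p q r).
rewrite <- pair_sum_minus. fold f.
enough (pair_sum lam 2 M r (fun p q => f p q + f q p) = 0) as E.
{ rewrite pair_sum_plus, (pair_sum_swap lam 2 M r f) in E. lra. }
transitivity (pair_sum lam 2 M r (fun _ _ => 0 * 0)).
2:{ rewrite (pair_sum_scal lam 2 M r 0 (fun _ _ => 0)). ring. }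
apply pair_sum_ext. intros p q Hp Hq T. rewrite Rmult_0_l.
apply box_inLamd in Hp; apply box_inLamd in Hq.
pose proof (field_dot0 lam 2 B u p Hu Hp) as Dp.
pose proof (field_dot0 lam 2 B u q Hu Hq) as Dq.
unfold f, transfer, enst_transfer.
match goal with |- Re ?a - Re ?b + (Re ?c - Re ?e) = 0 =>
  change (Re (Cplus (Cminus a b) (Cminus c e)) = Re (RtoC 0)) end.
f_equal. unfold dpart. unfold_csum. cbn [enst_dual].
set (w := vort2 u r); clearbody w. unfold vort2.
rewrite !(triad_RtoC 2 p q r 0), !(triad_RtoC 2 p q r 1) by (auto; lia).
(* The symmetrised difference is a combination of the divergences p.u(p) and q.u(q), each
   multiplied, up to a constant and w(r), by the curl at the other vector. *)
match type of Dp with ?dp = _ => match type of Dq with ?dq = _ =>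
  transitivity (Cmult (Cmult (Cmult Ci Ci) w) (Cplus
    (Cmult dp (Cminus (Cmult (RtoC (q 0%nat)) (u 1%nat q)) (Cmult (RtoC (q 1%nat)) (u 0%nat q))))
    (Cmult dq (Cminus (Cmult (RtoC (p 0%nat)) (u 1%nat p)) (Cmult (RtoC (p 1%nat)) (u 0%nat p))))))
  end end; [ring|rewrite Dp, Dq; ring].
Qed.

Lemma inbox_compl lam d N p : ~ inbox lam d N p ->
  exists i, (i < d)%nat /\ lam ^ N <= Rabs (p i).
Proof.
intros H. apply NNPP; intros Hn. apply H. intros i Hi.
apply Rnot_le_lt; intros L. apply Hn; eauto.
Qed.

(** If p stays in box N, then q leaves it in some coordinate i. There |r_i| < lam ^ N <= |q_i|, so
    p_i is nonzero and [triad_comparable] bounds q_i by p_i. As every coordinate of r is below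
    [lam ^ N], this makes |r| at most a multiple of |p|. *)
Lemma triad_leaving_box lam d N M p q r : 1 < lam ->
  In r (box lam N d) -> In p (box lam M d) -> In q (box lam M d) -> triad d p q r ->
  ~ (inbox lam d N p /\ inbox lam d N q) ->
  exists i, (i < d)%nat /\ (lam - 1) * lam ^ N <= lam * Rabs (p i).
Proof.
intros lam_gt1 Hr Hp Hq T Hno.
destruct (classic (inbox lam d N p)) as [Ip|Ip].
- destruct (inbox_compl lam d N q ltac:(tauto)) as [i [Hi Li]]. exists i; split; auto.
  pose proof (box_inbox lam lam_gt1 d N r Hr i Hi) as Lr.
  specialize (T i Hi).
  apply Rle_trans with ((lam - 1) * Rabs (q i)); [apply Rmult_le_compat_l; lra|].
  apply (triad_comparable lam lam_gt1 (max N M) (p i) (q i) (r i)); auto.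
  + apply (lam_list_mono lam M); [lia|]. now apply (box_In _ _ _ _ Hp).
  + apply (lam_list_mono lam M); [lia|]. now apply (box_In _ _ _ _ Hq).
  + apply (lam_list_mono lam N); [lia|]. now apply (box_In _ _ _ _ Hr).
  + intros E. replace (q i) with (- r i) in Li by lra. rewrite Rabs_Ropp in Li. lra.
- destruct (inbox_compl lam d N p Ip) as [i [Hi Li]]. exists i; split; auto.
  pose proof (pow_lt lam N ltac:(lra)). nra.
Qed.

Lemma enstrophy_balance lam B u v P :
  1 < lam -> admissible_field lam 2 B u -> momentum_equation lam 2 u v P ->
  is_lim_seq (fun N => Rsum (box lam N 2)
    (fun k => Re (Csum (seq 0 2) (fun i => Cmult (v i k) (Cconj (enst_dual u i k)))))) 0.
Proof.
intros lam_gt1 Hu Heq.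
assert (C0 : 0 <= lam / (lam - 1)) by (apply Rlt_le, Rdiv_lt_0_compat; lra).
apply (balance_lim0 lam 2 B u lam_gt1 Hu (enst_dual u) v P (enst_transfer u)
  (8 * (lam / (lam - 1)))); auto.
- intros i Hi k Hk.
  pose proof (field_real _ _ _ _ Hu 0%nat ltac:(lia) k Hk) as E0.
  pose proof (field_real _ _ _ _ Hu 1%nat ltac:(lia) k Hk) as E1.
  destruct i as [|[|i]]; [| |lia]; cbn [enst_dual]; unfold vort2; rewrite E0, E1;
  rewrite ?Copp_conj, !Cmult_conj, Cminus_conj, !Cmult_conj, !Cconj_RtoC, Cconj_Ci;
  unfold vneg; rewrite !RtoC_opp; ring.
- intros [|[|i]] Hi; cbn [enst_dual]; auto; ring.
- intros k Hk. unfold_csum. cbn [enst_dual]. ring.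
- lra.
- intros M r _. now apply (enst_transfer_pair lam B).
- intros N M p q r Hr Hp Hq T Hno.
  destruct (triad_leaving_box lam 2 N M p q r lam_gt1 Hr Hp Hq T Hno) as [i [Hi Li]].
  pose proof (amp_nonneg 2 u p) as Ap. pose proof (amp_nonneg 2 u q) as Aq.
  pose proof (amp_nonneg 2 u r) as Ar.
  unfold enst_transfer. eapply Rle_trans; [apply re_le_Cmod|].
  rewrite !Cmod_mult, Cmod_Ci, Rmult_1_l.
  replace (8 * (lam / (lam - 1)) * (amp 2 u p * amp 2 u q * amp 2 u r))
    with ((INR 2 * (lam / (lam - 1) * amp 2 u p)) * ((2 * amp 2 u q) * (2 * amp 2 u r)))
    by (simpl; ring).
  apply Rmult_le_compat; try apply Cmod_ge_0.
  + apply Rmult_le_pos; apply Cmod_ge_0.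
  + pose proof (field_dot0 lam 2 B u p Hu (box_inLamd _ _ _ _ Hp)) as D.
    replace (Csum (seq 0 2) (fun j => Cmult (u j p) (RtoC (q j))))
      with (Csum (seq 0 2) (fun j => Cmult (u j p) (Copp (RtoC (r j))))).
    * apply Cmod_Csum_le; intros j Hj. rewrite Cmod_mult, Cmod_opp, Cmod_R.
      pose proof (box_inbox lam lam_gt1 2 N r Hr j Hj) as Lr.
      pose proof (amp_deriv 2 u p j i Hj Hi) as Ad.
      pose proof (Cmod_ge_0 (u j p)) as Cp.
      (* The derivative moves from r to p: |r_j| < lam ^ N <= lam / (lam - 1) |p_i|, where i is the
         coordinate in which the triad leaves the box. *)
      apply Rle_trans with (Cmod (u j p) * (lam / (lam - 1) * Rabs (p i))).
      -- apply Rmult_le_compat_l; auto.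
         apply Rle_trans with (lam ^ N); [lra|].
         apply Rmult_le_reg_l with (lam - 1); [lra|].
         replace ((lam - 1) * (lam / (lam - 1) * Rabs (p i))) with (lam * Rabs (p i))
           by (field; lra). exact Li.
      -- replace (Cmod (u j p) * (lam / (lam - 1) * Rabs (p i)))
           with (lam / (lam - 1) * (Rabs (p i) * Cmod (u j p))) by ring.
         now apply Rmult_le_compat_l.
    * unfold_csum.
      rewrite !(triad_RtoC 2 p q r 0), !(triad_RtoC 2 p q r 1) by (auto; lia).
      transitivity (Cplus (Cplus (Cmult (u 0%nat p) (RtoC (q 0%nat)))
        (Cplus (Cmult (u 1%nat p) (RtoC (q 1%nat))) (RtoC 0))) (RtoC 0)); [|ring].
      rewrite <- D at 2. ring.
  + apply Rmult_le_compat; try apply Cmod_ge_0; apply Cmod_vort2.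
- intros N. apply triad_sum_antisym23. intros p q r Hp _ _ T.
  apply box_inLamd in Hp. pose proof (field_dot0 lam 2 B u p Hu Hp) as D.
  unfold enst_transfer. eapply Re_eq0 with (1 := D).
  (* As for the energy: the two terms add up to i u(p).(q + r) w(q) w(r), and q + r = -p. *)
  instantiate (1 := Cmult (Copp Ci) (Cmult (vort2 u q) (vort2 u r))).
  unfold_csum.
  generalize (vort2 u q) (vort2 u r); intros wq wr.
  rewrite !(triad_RtoC 2 p q r 0), !(triad_RtoC 2 p q r 1) by (auto; lia). ring.
Qed.

(** * Quadratic forms along a solution *)

Lemma lam_admissible_gt1 lam : lam_admissible lam -> 1 < lam.
Proof.
intros [->|[H|[H _]]]; [lra| |assumption].
(* Written as lam (lam^2 - 1) = 1, the cubic has no root up to 1: the left side is at most 0 on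
   [0, 1] and below -1, and less than 1 on [-1, 0). *)
apply Rnot_le_lt; intros L. assert (E : lam * (lam * lam - 1) = 1) by (simpl in H; lra).
destruct (Rle_or_lt 0 lam) as [P|P]; [nra|].
destruct (Rle_or_lt (-1) lam) as [Q|Q].
- assert (0 <= (1 + lam) * (1 - lam * lam)) by (apply Rmult_le_pos; nra). nra.
- assert (0 < lam * lam - 1) by nra. nra.
Qed.

Lemma inI_margin T t : inI T t ->
  exists dl, 0 < dl /\ forall x, 0 <= x -> x < t + dl -> inI T x.
Proof.
intros [H0 H]. destruct T as [T| |]; simpl in H; [| |tauto].
- exists (T - t). split; [lra|]. intros x Hx Hx'. split; simpl; lra.
- exists 1. split; [lra|]. intros x Hx _. split; simpl; auto.
Qed.

(* The even extension of [f] turns the one-sided derivative at 0 into a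
   two-sided one. *)
Lemma zero_derivative_const T (f : R -> R) :
  (forall t, inI T t -> forall eta, 0 < eta -> exists dl, 0 < dl /\
     forall h, h <> 0 -> Rabs h < dl -> inI T (t + h) -> Rabs (f (t + h) - f t) <= eta * Rabs h) ->
  forall t s, inI T t -> inI T s -> f t = f s.
Proof.
intros Hf.
assert (A : forall a b, inI T a -> inI T b -> a < b -> f a = f b).
{ intros a b Ha Hb Hab. destruct Ha as [Ha _]. destruct Hb as [Hb Hb'].
  rewrite <- (Rabs_pos_eq a), <- (Rabs_pos_eq b) by lra.
  apply (eq_is_derive (fun x => f (Rabs x)) a b); auto.
  intros x [Hx Hx']. apply is_derive_Reals. intros eps Heps.
  assert (Ix : inI T x).
  { split; [lra|]. eapply Rbar_le_lt_trans; [|exact Hb']. exact Hx'. }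
  destruct (Hf x Ix (eps / 2) ltac:(lra)) as [d1 [Hd1 Hd]].
  destruct (inI_margin T x Ix) as [d2 [Hd2 HI]].
  assert (Hm : 0 < Rmin d1 d2) by (apply Rmin_glb_lt; auto).
  exists (mkposreal _ Hm). simpl. intros h Hh0 Hh.
  pose proof (Rmin_l d1 d2). pose proof (Rmin_r d1 d2).
  rewrite (Rabs_pos_eq x) by lra. unfold zero; simpl. rewrite Rminus_0_r.
  unfold Rdiv. rewrite Rabs_mult, Rabs_inv.
  pose proof (Rabs_pos_lt h Hh0) as Ph.
  (* The increment from x to |x + h| is no larger than [h], but it can vanish while [h] does not,
     when x + h = -x; that case is treated apart. *)
  set (h' := Rabs (x + h) - x).
  assert (Eh : Rabs h' <= Rabs h).
  { unfold h'. pose proof (Rabs_triang_inv2 (x + h) x) as T2.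
    rewrite (Rabs_pos_eq x) in T2 by lra. now replace (x + h - x) with h in T2 by ring. }
  replace (Rabs (x + h)) with (x + h') by (unfold h'; ring).
  apply Rle_lt_trans with (eps / 2 * Rabs h * / Rabs h); [|field_simplify; lra].
  apply Rmult_le_compat_r; [apply Rlt_le, Rinv_0_lt_compat, Ph|].
  destruct (Req_dec h' 0) as [->|Hh'].
  - rewrite Rplus_0_r, Rminus_diag, Rabs_R0. nra.
  - eapply Rle_trans; [apply Hd; auto; [lra|]|].
    + apply HI; unfold h'; replace (x + (Rabs (x + h) - x)) with (Rabs (x + h)) by ring;
        [apply Rabs_pos|].
      eapply Rle_lt_trans; [apply Rabs_triang|]. rewrite (Rabs_pos_eq x); lra.
    + apply Rmult_le_compat_l; lra. }
intros t s Ht Hs. destruct (Rtotal_order t s) as [L|[->|L]]; auto. symmetry; auto.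
Qed.

Lemma Cmod_sqr_plus a b : Cmod (Cplus a b) ^ 2 <= 2 * Cmod a ^ 2 + 2 * Cmod b ^ 2.
Proof.
pose proof (Cmod_triangle a b) as H. pose proof (Cmod_ge_0 (Cplus a b)).
pose proof (pow2_ge_0 (Cmod a - Cmod b)).
assert (Cmod (Cplus a b) ^ 2 <= (Cmod a + Cmod b) ^ 2) by (apply pow_incr; lra). nra.
Qed.

Lemma nrm2_plus d x y : nrm2 d (fun i => Cplus (x i) (y i)) <= 2 * nrm2 d x + 2 * nrm2 d y.
Proof.
unfold nrm2. rewrite <- !Rsum_scal, <- Rsum_plus. apply Rsum_le; intros; apply Cmod_sqr_plus.
Qed.

Lemma nrm2_scal d r x : nrm2 d (fun i => Cmult (RtoC r) (x i)) = r ^ 2 * nrm2 d x.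
Proof.
unfold nrm2. rewrite <- Rsum_scal. apply Rsum_ext; intros i.
rewrite Cmod_mult, Cmod_R, Rpow_mult_distr, RPow_abs, Rabs_pos_eq; auto using pow2_ge_0.
Qed.

Lemma hm_term_nonneg d m u k :
  0 <= (if cdec (vnonzero d k) then knorm2 d k ^ m * nrm2 d (fun i => u i k) else 0).
Proof.
case_cdec (vnonzero d k); [|lra].
apply Rmult_le_pos; [apply pow_le, knorm2_nonneg|apply nrm2_nonneg].
Qed.

(** Since [real] sends an infinite limit to 0, [hm_sq] controls the partial sums only together with
    a bound on them. This part of [inV] is all that the norm estimates use. *)
Definition hm_bounded (lam : R) (d m : nat) (u : vfield) : Prop :=
  (forall i, (i < d)%nat -> u i (fun _ => 0) = RtoC 0) /\
  exists B, forall N, hm_partial lam d m u N <= B.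

Lemma inV_hm_bounded lam d m u : inV lam d m u -> hm_bounded lam d m u.
Proof. intros (_ & H0 & _ & HB). now split. Qed.

Lemma hm_bounded_lin lam d m r u v :
  hm_bounded lam d m u -> hm_bounded lam d m v ->
  hm_bounded lam d m (fun i k => Cplus (u i k) (Cmult (RtoC r) (v i k))).
Proof.
intros [Hu [A HA]] [Hv [B HB]]. split.
- intros i Hi. rewrite Hu, Hv by auto. ring.
- exists (2 * A + 2 * r ^ 2 * B). intros N. specialize (HA N). specialize (HB N).
  pose proof (pow2_ge_0 r).
  apply Rle_trans with (2 * hm_partial lam d m u N + 2 * r ^ 2 * hm_partial lam d m v N); [|nra].
  unfold hm_partial. rewrite <- !Rsum_scal, <- Rsum_plus. apply Rsum_le; intros k _.
  case_cdec (vnonzero d k); [|lra].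
  fold (nrm2 d (fun i => u i k)) (nrm2 d (fun i => v i k)).
  fold (nrm2 d (fun i => Cplus (u i k) (Cmult (RtoC r) (v i k)))).
  pose proof (nrm2_plus d (fun i => u i k) (fun i => Cmult (RtoC r) (v i k))) as E.
  rewrite nrm2_scal in E. pose proof (pow_le _ m (knorm2_nonneg d k)). nra.
Qed.

Section Time.
Variable lam : R.
Hypothesis lam_gt1 : 1 < lam.

Lemma hm_partial_le d m u N : hm_bounded lam d m u -> hm_partial lam d m u N <= hm_sq lam d m u.
Proof.
intros [_ [B HB]].
assert (Mono : forall n, hm_partial lam d m u n <= hm_partial lam d m u (S n)).
{ intros n. apply Rsum_box_mono; auto. intros k _. apply hm_term_nonneg. }
destruct (ex_finite_lim_seq_incr _ B Mono HB) as [l Hl].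
unfold hm_sq. rewrite (is_lim_seq_unique _ _ Hl). now apply is_lim_seq_incr_compare.
Qed.

(** On nonzero lattice vectors |k| >= 1, so 1 + |k|^2 <= 2 |k|^(2m); at k = 0 the field vanishes. *)
Lemma weight_le d m u N : (1 <= m)%nat -> hm_bounded lam d m u ->
  Rsum (box lam N d) (fun k => (1 + knorm2 d k) * nrm2 d (fun i => u i k)) <= 2 * hm_sq lam d m u.
Proof.
intros Hm Hu. eapply Rle_trans; [|apply Rmult_le_compat_l; [lra|now apply (hm_partial_le _ _ _ N)]].
unfold hm_partial. rewrite <- Rsum_scal. apply Rsum_le; intros k Hk.
fold (nrm2 d (fun i => u i k)). pose proof (nrm2_nonneg d (fun i => u i k)) as Hn.
case_cdec (vnonzero d k).
- pose proof (knorm2_ge1 lam lam_gt1 N d k Hk H) as K.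
  assert (knorm2 d k <= knorm2 d k ^ m).
  { rewrite <- (pow_1 (knorm2 d k)) at 1. now apply Rle_pow. }
  nra.
- rewrite (box_zero _ _ _ _ Hk H). unfold nrm2. rewrite (Rsum_ext_in _ _ (fun _ => 0)).
  + rewrite Rsum_zero. lra.
  + intros i Hi. apply in_seq in Hi. rewrite (proj1 Hu) by lia. rewrite Cmod_0. ring.
Qed.

Lemma hm_sq_nonneg d m u : (1 <= m)%nat -> hm_bounded lam d m u -> 0 <= hm_sq lam d m u.
Proof.
intros Hm Hu. pose proof (weight_le d m u 0 Hm Hu).
assert (0 <= Rsum (box lam 0 d) (fun k => (1 + knorm2 d k) * nrm2 d (fun i => u i k))); [|lra].
apply Rsum_nonneg; intros k _. pose proof (knorm2_nonneg d k).
pose proof (nrm2_nonneg d (fun i => u i k)). nra.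
Qed.

(** [form_le] is the bound by (1 + |k|^2) |x| |y| in its weighted arithmetic-geometric form: it
    avoids square roots, and [s] is free to balance a small argument against a large one. *)
Record controlled_form (d : nat) (b : wvec -> (nat -> C) -> (nat -> C) -> R) (c : R) : Prop := {
  form_sym : forall k x y, b k x y = b k y x;
  form_lin : forall k x y z r,
    b k (fun i => Cplus (x i) (Cmult (RtoC r) (y i))) z = b k x z + r * b k y z;
  form_cst : 0 <= c;
  form_le : forall k x y s, 0 < s ->
    Rabs (b k x y) <= c * ((1 + knorm2 d k) * (s * nrm2 d x + / s * nrm2 d y)) }.

Definition form_sum (d : nat) (b : wvec -> (nat -> C) -> (nat -> C) -> R) (u v : vfield) (N : nat) : R :=
  Rsum (box lam N d) (fun k => b k (fun i => u i k) (fun i => v i k)).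

Lemma form_sum_le d m b c u v N s : (1 <= m)%nat -> controlled_form d b c ->
  hm_bounded lam d m u -> hm_bounded lam d m v -> 0 < s ->
  Rabs (form_sum d b u v N) <= 2 * c * (s * hm_sq lam d m u + / s * hm_sq lam d m v).
Proof.
intros Hm Hb Hu Hv Hs. pose proof (form_cst _ _ _ Hb) as Hc.
pose proof (weight_le d m u N Hm Hu) as Wu. pose proof (weight_le d m v N Hm Hv) as Wv.
pose proof (Rinv_0_lt_compat s Hs) as Hs'.
eapply Rle_trans; [apply Rsum_Rabs|].
eapply Rle_trans.
{ apply Rsum_le; intros k _. now apply (form_le _ _ _ Hb _ _ _ s). }
rewrite Rsum_scal.
rewrite (Rsum_ext _ _ (fun k => s * ((1 + knorm2 d k) * nrm2 d (fun i => u i k)) +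
  / s * ((1 + knorm2 d k) * nrm2 d (fun i => v i k)))) by (intros; ring).
rewrite Rsum_plus, !Rsum_scal.
replace (2 * c * (s * hm_sq lam d m u + / s * hm_sq lam d m v))
  with (c * (s * (2 * hm_sq lam d m u) + / s * (2 * hm_sq lam d m v))) by ring.
apply Rmult_le_compat_l; auto. apply Rplus_le_compat; apply Rmult_le_compat_l; lra.
Qed.

Lemma form_sum_cv d m b c u : (1 <= m)%nat -> controlled_form d b c ->
  hm_bounded lam d m u -> ex_finite_lim_seq (form_sum d b u u).
Proof.
intros Hm Hb Hu. pose proof (form_cst _ _ _ Hb) as Hc.
apply ex_finite_lim_seq_dominated with (B := c * (2 * (2 * hm_sq lam d m u)))
  (t := fun N => Rsum (box lam N d)
    (fun k => c * (2 * ((1 + knorm2 d k) * nrm2 d (fun i => u i k))))).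
- intros N. apply Rsum_box_diff; auto. intros k _.
  eapply Rle_trans; [apply (form_le _ _ _ Hb _ _ _ 1); lra|]. apply Req_le. field.
- intros N. rewrite !Rsum_scal. apply Rmult_le_compat_l; auto.
  pose proof (weight_le d m u N Hm Hu). lra.
Qed.

Lemma form_sum_expand d b c u v w h N : controlled_form d b c ->
  (forall i k, v i k = Cplus (u i k) (Cmult (RtoC h) (w i k))) ->
  form_sum d b v v N =
  form_sum d b u u N + 2 * h * form_sum d b w u N + h ^ 2 * form_sum d b w w N.
Proof.
intros Hb Hv. unfold form_sum. rewrite <- !Rsum_scal, <- !Rsum_plus. apply Rsum_ext; intros k.
replace (fun i => v i k) with (fun i => Cplus (u i k) (Cmult (RtoC h) (w i k)))
  by (apply functional_extensionality; intros; now rewrite Hv).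
pose proof (form_lin _ _ _ Hb k (fun i => u i k) (fun i => w i k)) as L. cbv beta in L.
rewrite L, (form_sym _ _ _ Hb k (fun i => u i k)), (form_sym _ _ _ Hb k (fun i => w i k)), !L.
rewrite (form_sym _ _ _ Hb k (fun i => u i k) (fun i => w i k)). ring.
Qed.

Lemma form_sum_lin d b c u v w r N : controlled_form d b c ->
  form_sum d b (fun i k => Cplus (u i k) (Cmult (RtoC r) (v i k))) w N =
  form_sum d b u w N + r * form_sum d b v w N.
Proof.
intros Hb. unfold form_sum. rewrite <- !Rsum_scal, <- !Rsum_plus. apply Rsum_ext; intros k.
apply (form_lin _ _ _ Hb).
Qed.

(** Write u(t+h) = u(t) + h w with w = u'(t) + e. The form changes by 2h b(u', u) + 2h b(e, u) + h^2
    b(w, w): the first term tends to 0 along the boxes, the other two are at most eta |h| / 2 each,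
    uniformly in N. *)
Lemma quadratic_invariant d m T u u' b c : (1 <= m)%nat -> controlled_form d b c ->
  C1_Vm lam d m T u u' ->
  (forall t, inI T t -> is_lim_seq (form_sum d b (u' t) (u t)) 0) ->
  forall t s, inI T t -> inI T s ->
    real (Lim_seq (form_sum d b (u t) (u t))) = real (Lim_seq (form_sum d b (u s) (u s))).
Proof.
intros Hm Hb (HV & HD & _) H0. pose proof (form_cst _ _ _ Hb) as Hc.
apply (zero_derivative_const T (fun t => real (Lim_seq (form_sum d b (u t) (u t))))).
intros t Ht eta Heta. destruct (HV t Ht) as [Vx Vy].
apply inV_hm_bounded in Vx; apply inV_hm_bounded in Vy.
set (X := hm_sq lam d m (u t)). set (Y := hm_sq lam d m (u' t)).
assert (PX : 0 <= X) by now apply hm_sq_nonneg.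
assert (PY : 0 <= Y) by now apply hm_sq_nonneg.
(* If the square norm of e is below s^2, [form_sum_le] with parameter 1/s bounds b(e, u) by 2c s (X
   + 1); this [s] makes twice that at most eta / 2. *)
set (s := Rmin 1 (eta / (8 * (c + 1) * (X + 1)))).
assert (Hs : 0 < s).
{ apply Rmin_glb_lt; [lra|]. apply Rdiv_lt_0_compat; auto. repeat apply Rmult_lt_0_compat; lra. }
assert (Hs1 : s <= 1) by apply Rmin_l.
assert (Hs2 : 4 * c * (s * (X + 1)) <= eta / 2).
{ assert (E : s * (8 * (c + 1) * (X + 1)) <= eta).
  { apply Rle_trans with (eta / (8 * (c + 1) * (X + 1)) * (8 * (c + 1) * (X + 1))).
    - apply Rmult_le_compat_r; [repeat apply Rmult_le_pos; lra|apply Rmin_r].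
    - apply Req_le. field. lra. }
  pose proof (Rmult_le_pos _ _ (Rlt_le _ _ Hs) (Rplus_le_le_0_compat _ _ PX Rle_0_1)). nra. }
destruct (HD t Ht (s ^ 2) ltac:(now apply pow_lt)) as [d1 [Hd1 Hd]].
(* Chosen so that |h| < d2 makes the quadratic term, bounded by 8c (Y + 1) h^2, at most eta |h| /
   2. *)
set (d2 := eta / (16 * (c + 1) * (Y + 1))).
assert (Hd2 : 0 < d2).
{ apply Rdiv_lt_0_compat; auto. repeat apply Rmult_lt_0_compat; lra. }
exists (Rmin d1 d2). split; [now apply Rmin_glb_lt|].
intros h Hh0 Hh Hth. pose proof (Rmin_l d1 d2). pose proof (Rmin_r d1 d2).
specialize (Hd h Hh0 ltac:(lra) Hth).
destruct (HV (t + h) Hth) as [Vv _]. apply inV_hm_bounded in Vv.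
set (e := vsub (vscal (/ h) (vsub (u (t + h)) (u t))) (u' t)) in *.
(* Smallness of [hm_sq lam d m e] says something about [e] only once its partial sums are bounded,
   so [e] is exhibited as a linear combination of bounded fields. *)
assert (Ve : hm_bounded lam d m e).
{ replace e with (fun i k => Cplus (Cplus (Copp (u' t i k)) (Cmult (RtoC (/ h)) (u (t + h) i k)))
    (Cmult (RtoC (- / h)) (u t i k))).
  - apply (hm_bounded_lin lam d m (- / h)
      (fun i k => Cplus (Copp (u' t i k)) (Cmult (RtoC (/ h)) (u (t + h) i k)))); auto.
    apply (hm_bounded_lin lam d m (/ h) (fun i k => Copp (u' t i k))); auto.
    destruct Vy as [Z [B HB]]. split.
    + intros i Hi. rewrite Z by auto. ring.
    + exists B. intros N. eapply Rle_trans; [|apply HB]. apply Req_le. unfold hm_partial.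
      apply Rsum_ext; intros k. case_cdec (vnonzero d k); auto. f_equal.
      apply Rsum_ext; intros i. now rewrite Cmod_opp.
  - apply functional_extensionality; intros i. apply functional_extensionality; intros k.
    unfold e, vsub, vscal. rewrite RtoC_opp. ring. }
set (w := fun i k => Cplus (u' t i k) (Cmult (RtoC 1) (e i k))).
assert (Vw : hm_bounded lam d m w) by now apply hm_bounded_lin.
assert (Ev : forall i k, u (t + h) i k = Cplus (u t i k) (Cmult (RtoC h) (w i k))).
{ intros i k. unfold w, e, vsub, vscal.
  transitivity (Cplus (u t i k) (Cmult (Cmult (RtoC h) (RtoC (/ h)))
    (Cminus (u (t + h) i k) (u t i k)))); [|ring].
  rewrite <- RtoC_mult, Rinv_r by auto. ring. }
assert (PE : 0 <= hm_sq lam d m e) by now apply hm_sq_nonneg.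
assert (Es : hm_sq lam d m e < 1) by nra.
(* The constant is 2c from [form_le] at s = 1, doubled by splitting w into u' and e, and doubled
   again by [weight_le]; the square norm of e is below 1. *)
assert (Ww : forall N, Rabs (form_sum d b w w N) <= 8 * c * (Y + 1)).
{ intros N. eapply Rle_trans; [apply Rsum_Rabs|].
  apply Rle_trans with (4 * c * Rsum (box lam N d) (fun k => (1 + knorm2 d k) * nrm2 d (fun i => u' t i k))
    + 4 * c * Rsum (box lam N d) (fun k => (1 + knorm2 d k) * nrm2 d (fun i => e i k))).
  - rewrite <- !Rsum_scal, <- Rsum_plus. apply Rsum_le; intros k _.
    eapply Rle_trans; [apply (form_le _ _ _ Hb _ _ _ 1); lra|].
    pose proof (nrm2_plus d (fun i => u' t i k) (fun i => Cmult (RtoC 1) (e i k))) as A.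
    rewrite nrm2_scal in A. fold (nrm2 d (fun i => w i k)) in *.
    change (nrm2 d (fun i => Cplus (u' t i k) (Cmult (RtoC 1) (e i k))))
      with (nrm2 d (fun i => w i k)) in A.
    pose proof (Rmult_le_compat_l _ _ _ (Rmult_le_pos _ _ Hc
      (Rplus_le_le_0_compat _ _ Rle_0_1 (knorm2_nonneg d k))) A) as A'.
    rewrite Rinv_1. nra.
  - pose proof (weight_le d m (u' t) N Hm Vy) as A1. pose proof (weight_le d m e N Hm Ve) as A2.
    fold Y in A1. nra. }
assert (Ew : forall N, Rabs (form_sum d b e (u t) N) <= 2 * c * (s * (X + 1))).
{ intros N. eapply Rle_trans; [apply (form_sum_le d m b c e (u t) N (/ s)); auto|].
  - now apply Rinv_0_lt_compat.
  - rewrite Rinv_inv. fold X. apply Rmult_le_compat_l; [lra|].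
    assert (/ s * hm_sq lam d m e <= s); [|lra].
    apply Rmult_le_reg_l with s; auto. rewrite <- Rmult_assoc, Rinv_r by lra. nra. }
set (Qt := form_sum d b (u t) (u t)). set (Qh := form_sum d b (u (t + h)) (u (t + h))).
pose proof (is_lim_seq_real _ (form_sum_cv d m b c (u t) Hm Hb Vx)) as Lt.
pose proof (is_lim_seq_real _ (form_sum_cv d m b c (u (t + h)) Hm Hb Vv)) as Lh.
(* Removing the vanishing sequence 2h b(u', u) leaves the limit unchanged and makes the estimate
   hold at every finite N. *)
pose proof (is_lim_seq_minus' _ _ _ _ (is_lim_seq_minus' _ _ _ _ Lh Lt)
  (is_lim_seq_mult' _ _ _ _ (is_lim_seq_const (2 * h)) (H0 t Ht))) as L.
rewrite Rmult_0_r, Rminus_0_r in L. apply is_lim_seq_abs in L.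
pose proof (Rabs_pos_lt h Hh0) as Ph.
refine (is_lim_seq_le _ _ _ _ _ L (is_lim_seq_const (eta * Rabs h))).
intros N. rewrite (form_sum_expand d b c (u t) (u (t + h)) w h N Hb Ev).
unfold w at 1. rewrite (form_sum_lin d b c) by auto. fold w.
specialize (Ww N). specialize (Ew N).
match goal with |- Rabs ?A <= _ =>
  replace A with (2 * h * form_sum d b e (u t) N + h ^ 2 * form_sum d b w w N) by ring end.
eapply Rle_trans; [apply Rabs_triang|].
rewrite !Rabs_mult, (Rabs_pos_eq 2), <- RPow_abs by lra.
assert (Hd2' : Rabs h * (8 * c * (Y + 1)) <= eta / 2).
{ apply Rle_trans with (d2 * (8 * (c + 1) * (Y + 1))).
  - apply Rmult_le_compat;
      [apply Rabs_pos|repeat apply Rmult_le_pos; lra|lra|apply Rmult_le_compat_r; lra].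
  - apply Req_le. unfold d2. field. lra. }
apply Rle_trans with (Rabs h * (2 * (2 * c * (s * (X + 1))) + Rabs h * (8 * c * (Y + 1)))).
- replace (Rabs h * (2 * (2 * c * (s * (X + 1))) + Rabs h * (8 * c * (Y + 1))))
    with (2 * Rabs h * (2 * c * (s * (X + 1))) + Rabs h ^ 2 * (8 * c * (Y + 1))) by ring.
  apply Rplus_le_compat; apply Rmult_le_compat_l; auto; [lra|apply pow2_ge_0].
- rewrite (Rmult_comm eta). apply Rmult_le_compat_l; lra.
Qed.

End Time.

(** * The three quadratic forms are controlled *)

Lemma weighted_AM_GM s a b : 0 < s -> a * b <= s * a ^ 2 + / s * b ^ 2.
Proof.
intros Hs. apply Rmult_le_reg_l with s; auto.
replace (s * (s * a ^ 2 + / s * b ^ 2)) with ((s * a) ^ 2 + b ^ 2) by (field; lra).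
pose proof (pow2_ge_0 (s * a - b)). nra.
Qed.

Lemma Re_Csum_lin d x y z r :
  Re (Csum (seq 0 d) (fun i => Cmult (Cplus (x i) (Cmult (RtoC r) (y i))) (z i))) =
  Re (Csum (seq 0 d) (fun i => Cmult (x i) (z i))) +
  r * Re (Csum (seq 0 d) (fun i => Cmult (y i) (z i))).
Proof.
rewrite !Re_Csum, <- Rsum_scal, <- Rsum_plus. apply Rsum_ext; intros i.
unfold Re, Cmult, Cplus, RtoC; simpl. ring.
Qed.

Definition energy_form (d : nat) (k : wvec) (x y : nat -> C) : R :=
  Re (Csum (seq 0 d) (fun i => Cmult (x i) (Cconj (y i)))).

(** [vort3] at k reads only the values at k, so the constant field [fun j _ => y j] yields its
    Fourier symbol acting on the vector [y]. *)
Definition helicity_form (k : wvec) (x y : nat -> C) : R :=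
  Re (Csum (seq 0 3) (fun i => Cmult (x i) (Cconj (vort3 (fun j _ => y j) i k)))).

Definition enstrophy_form (k : wvec) (x y : nat -> C) : R :=
  Re (Cmult (vort2 (fun j _ => x j) k) (Cconj (vort2 (fun j _ => y j) k))).

Lemma energy_form_controlled d : controlled_form d (energy_form d) 1.
Proof.
split; [| |lra|].
- intros k x y. unfold energy_form. rewrite <- re_conj, <- Csum_conj. f_equal.
  apply Csum_ext_in; intros i _. rewrite Cmult_conj, Cconj_conj. ring.
- intros. apply Re_Csum_lin.
- intros k x y s Hs. rewrite Rmult_1_l. eapply Rle_trans; [apply re_le_Cmod|].
  eapply Rle_trans; [apply Cmod_Csum|].
  apply Rle_trans with (s * nrm2 d x + / s * nrm2 d y).
  + unfold nrm2. rewrite <- !Rsum_scal, <- Rsum_plus. apply Rsum_le; intros i _.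
    rewrite Cmod_mult, Cmod_conj. now apply weighted_AM_GM.
  + pose proof (Rinv_0_lt_compat s Hs).
    pose proof (knorm2_nonneg d k). pose proof (nrm2_nonneg d x). pose proof (nrm2_nonneg d y).
    assert (0 <= s * nrm2 d x + / s * nrm2 d y)
      by (apply Rplus_le_le_0_compat; apply Rmult_le_pos; lra).
    nra.
Qed.

(** The symbol of the curl, x |-> i k x x, is a Hermitian matrix. *)
Lemma helicity_conj x y k :
  Csum (seq 0 3) (fun i => Cmult (x i) (Cconj (vort3 (fun j _ => y j) i k))) =
  Cconj (Csum (seq 0 3) (fun i => Cmult (y i) (Cconj (vort3 (fun j _ => x j) i k)))).
Proof.
rewrite <- Csum_conj. unfold_csum. cbn [vort3].
rewrite !Cmult_conj, !Cconj_conj, !Cminus_conj, !Cmult_conj, !Cconj_RtoC, Cconj_Ci. ring.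
Qed.

(** The single derivative is placed on y: |x| |k| |y| <= s |x|^2 + |k|^2 |y|^2 / s, and both terms
    fit under the weight 1 + |k|^2. The 6 is 2 from [Cmod_vort3] for each of 3 components. *)
Lemma helicity_form_controlled : controlled_form 3 helicity_form 6.
Proof.
split; [| |lra|].
- intros k x y. unfold helicity_form. now rewrite helicity_conj, re_conj.
- intros. apply Re_Csum_lin.
- intros k x y s Hs. eapply Rle_trans; [apply re_le_Cmod|].
  replace (6 * ((1 + knorm2 3 k) * (s * nrm2 3 x + / s * nrm2 3 y)))
    with (INR 3 * (2 * ((1 + knorm2 3 k) * (s * nrm2 3 x + / s * nrm2 3 y)))) by (simpl; ring).
  apply Cmod_Csum_le; intros i Hi. rewrite Cmod_mult, Cmod_conj.
  pose proof (Cmod_vort3 (fun j _ => y j) k i Hi) as V.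
  set (A := amp 3 (fun j _ => y j) k) in *.
  assert (EA : A ^ 2 = knorm2 3 k * nrm2 3 y) by apply amp_sqr.
  pose proof (nrm2_ge 3 x i Hi) as Hx.
  pose proof (weighted_AM_GM s (Cmod (x i)) A Hs) as E.
  pose proof (Rinv_0_lt_compat s Hs) as Hs'.
  pose proof (knorm2_nonneg 3 k) as Hk. pose proof (nrm2_nonneg 3 x) as Nx.
  pose proof (nrm2_nonneg 3 y) as Ny. pose proof (Cmod_ge_0 (x i)) as Cx.
  apply Rle_trans with (2 * (Cmod (x i) * A)); [nra|].
  apply Rmult_le_compat_l; [lra|]. rewrite EA in E. eapply Rle_trans; [exact E|].
  pose proof (Rmult_le_compat_l s _ _ (Rlt_le _ _ Hs) Hx) as E1.
  pose proof (Rmult_le_pos _ _ (Rlt_le _ _ Hs) Nx) as P1.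
  pose proof (Rmult_le_pos _ _ (Rlt_le _ _ Hs') Ny) as P2.
  pose proof (Rmult_le_pos _ _ Hk P1). nra.
Qed.

Lemma enstrophy_form_controlled : controlled_form 2 enstrophy_form 4.
Proof.
split; [| |lra|].
- intros k x y. unfold enstrophy_form. rewrite <- re_conj, Cmult_conj, Cconj_conj. f_equal. ring.
- intros k x y z r. unfold enstrophy_form.
  generalize (Cconj (vort2 (fun j _ => z j) k)); intros c. unfold vort2.
  unfold Re, Cmult, Cplus, Cminus, Copp, RtoC, Ci; simpl. ring.
- intros k x y s Hs. eapply Rle_trans; [apply re_le_Cmod|].
  rewrite Cmod_mult, Cmod_conj.
  pose proof (Cmod_vort2 (fun j _ => x j) k) as Vx. pose proof (Cmod_vort2 (fun j _ => y j) k) as Vy.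
  set (X := amp 2 (fun j _ => x j) k) in *. set (Y := amp 2 (fun j _ => y j) k) in *.
  assert (EX : X ^ 2 = knorm2 2 k * nrm2 2 x) by apply amp_sqr.
  assert (EY : Y ^ 2 = knorm2 2 k * nrm2 2 y) by apply amp_sqr.
  apply Rle_trans with ((2 * X) * (2 * Y)); [apply Rmult_le_compat; auto using Cmod_ge_0|].
  pose proof (weighted_AM_GM s X Y Hs) as E. rewrite EX, EY in E.
  pose proof (Rinv_0_lt_compat s Hs) as Hs'.
  pose proof (Rmult_le_pos _ _ (Rlt_le _ _ Hs) (nrm2_nonneg 2 x)) as P1.
  pose proof (Rmult_le_pos _ _ (Rlt_le _ _ Hs') (nrm2_nonneg 2 y)) as P2.
  lra.
Qed.

Lemma inV_admissible lam d m u : 1 < lam -> (1 <= m)%nat -> inV lam d m u ->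
  admissible_field lam d (hm_sq lam d m u) u.
Proof.
intros lam_gt1 Hm Hu. pose proof (inV_hm_bounded _ _ _ _ Hu) as Hb.
destruct Hu as (Hr & H0 & Hd & _). split; auto.
intros N. eapply Rle_trans; [apply (amp_sum lam lam_gt1 N d m u Hm)|].
now apply hm_partial_le.
Qed.

(** * Inner products as limits of real forms, and the conservation laws *)

Lemma Clim_real s Q : (forall N, Re (s N) = Q N) -> (forall N, Im (s N) = 0) ->
  Clim s = RtoC (real (Lim_seq Q)).
Proof.
intros HR HI. unfold Clim, RtoC. f_equal.
- now rewrite (Lim_seq_ext _ _ HR).
- now rewrite (Lim_seq_ext _ _ HI), Lim_seq_const.
Qed.

Lemma Im_conj_eq0 z : z = Cconj z -> Im z = 0.
Proof. intros H. apply (f_equal Im) in H. rewrite im_conj in H. lra. Qed.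

(** The conserved quantities have complex type; each summand equals its own conjugate, so only the
    real part carries a limit. *)
Lemma inner_form lam d n f g (Q : nat -> R) :
  (forall N, Rsum (box lam N d)
     (fun k => Re (Csum (seq 0 n) (fun i => Cmult (f i k) (Cconj (g i k))))) = Q N) ->
  (forall k, Csum (seq 0 n) (fun i => Cmult (f i k) (Cconj (g i k))) =
     Cconj (Csum (seq 0 n) (fun i => Cmult (f i k) (Cconj (g i k))))) ->
  inner lam d n f g = RtoC (real (Lim_seq Q)).
Proof.
intros HQ HI. apply Clim_real; intros N.
- now rewrite Re_Csum.
- rewrite Im_Csum. apply Rsum_eq0; intros k. apply Im_conj_eq0, HI.
Qed.

Lemma Csum_sqr_conj d (f : nat -> C) :
  Csum (seq 0 d) (fun i => Cmult (f i) (Cconj (f i))) =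
  Cconj (Csum (seq 0 d) (fun i => Cmult (f i) (Cconj (f i)))).
Proof.
rewrite <- Csum_conj. apply Csum_ext_in; intros i _. rewrite Cmult_conj, Cconj_conj. ring.
Qed.

Theorem theorem5 (lam : R) (d m : nat) (T : Rbar) (u : R -> vfield) (p : R -> sfield) :
  lam_admissible lam ->
  (d = 2%nat \/ d = 3%nat) ->
  (1 <= m)%nat ->
  strong_solution lam d m T u p ->
  (forall t s, inI T t -> inI T s -> energy lam d (u t) = energy lam d (u s)) /\
  (d = 3%nat -> forall t s, inI T t -> inI T s -> helicity lam (u t) = helicity lam (u s)) /\
  (d = 2%nat -> forall t s, inI T t -> inI T s -> enstrophy lam (u t) = enstrophy lam (u s)).
Proof.
intros Hlam Hd Hm (u' & HC & _ & Heq).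
pose proof (lam_admissible_gt1 lam Hlam) as lam_gt1.
assert (Hadm : forall t, inI T t -> admissible_field lam d (hm_sq lam d m (u t)) (u t)).
{ intros t Ht. apply inV_admissible; auto. now apply (proj1 HC). }
split; [|split].
- intros t s Ht Hs. unfold energy. f_equal.
  assert (E : forall r, inner lam d d (u r) (u r) =
    RtoC (real (Lim_seq (form_sum lam d (energy_form d) (u r) (u r))))).
  { intros r. apply inner_form; [reflexivity|]. intros k. apply (Csum_sqr_conj d (fun i => u r i k)). }
  rewrite !E. f_equal. apply (quadratic_invariant lam lam_gt1 d m T u u' _ 1); auto using energy_form_controlled.
  intros r Hr. exact (energy_balance lam d _ (u r) (u' r) (p r) lam_gt1 Hd (Hadm r Hr) (Heq r Hr)).
- intros -> t s Ht Hs. unfold helicity.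
  assert (E : forall r, inner lam 3 3 (u r) (vort3 (u r)) =
    RtoC (real (Lim_seq (form_sum lam 3 helicity_form (u r) (u r))))).
  { intros r. apply inner_form; [reflexivity|]. intros k.
    apply (helicity_conj (fun i => u r i k) (fun i => u r i k)). }
  rewrite !E. f_equal. apply (quadratic_invariant lam lam_gt1 3 m T u u' _ 6); auto using helicity_form_controlled.
  intros r Hr. exact (helicity_balance lam _ (u r) (u' r) (p r) lam_gt1 (Hadm r Hr) (Heq r Hr)).
- intros -> t s Ht Hs. unfold enstrophy. f_equal.
  assert (E : forall r, inner lam 2 1 (fun _ => vort2 (u r)) (fun _ => vort2 (u r)) =
    RtoC (real (Lim_seq (form_sum lam 2 enstrophy_form (u r) (u r))))).
  { intros r. apply inner_form; [|intros; apply (Csum_sqr_conj 1 (fun _ => vort2 (u r) k))].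
    intros N. apply Rsum_ext; intros k. rewrite Re_Csum. simpl. rewrite Rplus_0_r. reflexivity. }
  rewrite !E. f_equal.
  apply (quadratic_invariant lam lam_gt1 2 m T u u' _ 4); auto using enstrophy_form_controlled.
  intros r Hr.
  (* [enstrophy_balance] pairs the full time derivative with [enst_dual]; [enst_dual_spec] turns
     this into the pairing of vorticities mode by mode. *)
  eapply is_lim_seq_ext;
    [|exact (enstrophy_balance lam _ (u r) (u' r) (p r) lam_gt1 (Hadm r Hr) (Heq r Hr))].
  intros N. apply Rsum_ext; intros k. rewrite <- enst_dual_spec. reflexivity.
Qed.
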